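(* There exists a measurable set $\Theta'\subset\Theta$ with $G(\Theta')=1$ such that for every pacing function $\mu:\Theta\to\mathbb{R}_{\ge0}$ and every buyer type $(w,B)\in\Theta'$ the following holds: if $t^*\in\arg\min_{t\ge0}q^\mu(w,B,t)$, then the bidding function $\alpha\mapsto\sigma^\mu_\alpha\big(w^T\alpha/(1+t^* )\big)$ is an optimal solution of the optimization problem $Q^\mu(w,B)$.
   Context: Setting. Fix integers $n\ge 2$ and $d\ge 2$, and constants $U>0$, $B_{\min}>0$. Buyer types are $\theta=(w,B)\in\Theta:=(0,U)^d\times(B_{\min},U)$; $\Theta_w:=(0,U)^d$. Item types are $\alpha\in A\subset\mathbb{R}^d_{+}$ (strictly positive orthant); all sets carry the Lebesgue $\sigma$-algebra. $F$ is a probability distribution on $A$ with a density and $G$ a probability distribution on $\Theta$ with a density. Buyer $(w,B)$ values item $\alpha$ at $w^T\alpha$; $\omega>0$ is a constant with $w^T\alpha\le\omega$ for all $w\in\Theta_w,\alpha\in A$. Reserve prices: measurable $r:A\to(0,\infty)$. A pacing function is a measurable $\mu:\Theta\to\mathbb{R}_{\ge0}$. For $\alpha\in A$, $\lambda^\mu_\alpha$ is the distribution of $w^T\alpha/(1+\mu(w,B))$ when $(w,B)\sim G$, and $H^\mu_\alpha$ the distribution of the maximum of $n-1$ i.i.d. draws from $\lambda^\mu_\alpha$; $H^\mu_\alpha(x):=\lambda^\mu_\alpha((-\infty,x])^{n-1}$. Define $\sigma^\mu_\alpha(x)=x$ if $x<r(\alpha)$; for $x\ge r(\alpha)$, $\sigma^\mu_\alpha(x)=x-\int_{r(\alpha)}^x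 \frac{H^\mu_\alpha(s)}{H^\mu_\alpha(x)}ds$ if $H^\mu_\alpha(x)>0$ and $\sigma^\mu_\alpha(x)=r(\alpha)$ if $H^\mu_\alpha(x)=0$. The value-pacing-based strategy is $\beta^\mu(w,B,\alpha):=\sigma^\mu_\alpha\big(w^T\alpha/(1+\mu(w,B))\big)$. $Q^\mu(w,B)$ is the problem $\max_{b:A\to\mathbb{R}_{\ge0}}\mathbb{E}_{\alpha,\{\theta_i\}_{i=1}^{n-1}}\big[(w^T\alpha-b(\alpha))\mathbf 1\{b(\alpha)\ge\max(r(\alpha),\{\beta^\mu(\theta_i,\alpha)\}_i)\}\big]$ subject to $\mathbb{E}_{\alpha,\{\theta_i\}}\big[b(\alpha)\mathbf 1\{b(\alpha)\ge\max(r(\alpha),\{\beta^\mu(\theta_i,\alpha)\}_i)\}\big]\le B$, over measurable $b$, with $\alpha\sim F$ and $\theta_1,\dots,\theta_{n-1}\sim G$ i.i.d. independent of $\alpha$. The (Lagrangian) dual function is $q^\mu(w,B,t):=(1+t)\,\mathbb{E}_{\alpha\sim F}\Big[\mathbf 1\Big\{\frac{w^T\alpha}{1+t}\ge r(\alpha)\Big\}\int_{r(\alpha)}^{\frac{w^T\alpha}{1+t}}H^\mu_\alpha(s)\,ds\Big]+tB$, for $t\ge0$. *)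

(* Defs.v *)
From HB Require Import structures.
From mathcomp Require Import all_boot all_order all_algebra.
From mathcomp Require Import all_classical all_reals all_analysis.
Set Implicit Arguments. Unset Strict Implicit. Unset Printing Implicit Defensive.
Import Order.TTheory GRing.Theory Num.Theory.
Import numFieldNormedType.Exports.
Local Open Scope classical_set_scope.
Local Open Scope ring_scope.

Fixpoint iprod {R : realType} {dT} {T : measurableType dT}
    (m : set T -> \bar R) (k : nat) : set (k.-tuple T) -> \bar R :=
  match k return set (k.-tuple T) -> \bar R with
  | 0 => fun S => (\1_S [tuple] : R)%:E
  | k'.+1 => fun S =>
      (m \x @iprod R dT T m k')%E [set p | S (cons_tuple p.1 p.2)]
  end.
Arguments iprod {R dT T} m k.

Section defs.
Context {R : realType} (d : nat).


Definition dotp (w a : d.-tuple R) : R := \sum_(i < d) tnth w i * tnth a i.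

Definition leb_vec : set (d.-tuple R) -> \bar R := iprod (@lebesgue_measure R) d.
Definition leb_typ : set (d.-tuple R * R)%type -> \bar R :=
  (leb_vec \x (@lebesgue_measure R))%E.

Definition has_density {dT} (T : measurableType dT) (m : set T -> \bar R)
    (P : set T -> \bar R) :=
  exists f : T -> R, measurable_fun [set: T] f /\ (forall x, 0 <= f x) /\
    forall S, measurable S -> P S = (\int[m]_(x in S) (f x)%:E)%E.

(* Lebesgue sigma-algebra = completion of the Borel one w.r.t. m *)
Definition leb_measurable {dT} (T : measurableType dT) (m : set T -> \bar R)
    (S : set T) :=
  exists B N, measurable B /\ measurable N /\ m N = 0%E /\
    (S `\` B) `|` (B `\` S) `<=` N.

(* f : D -> R measurable for the trace on D of the Lebesgue sigma-algebra
   (codomain: Borel sets of R) *)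
Definition leb_measurable_fun {dT} (T : measurableType dT) (m : set T -> \bar R)
    (D : set T) (f : T -> R) :=
  forall Y : set R, measurable Y ->
    exists L, leb_measurable m L /\ D `&` f @^-1` Y = D `&` L.

Definition Theta_w (U : R) : set (d.-tuple R) :=
  [set w | forall i, 0 < tnth w i < U].
Definition Theta (U Bmin : R) : set (d.-tuple R * R)%type :=
  [set th | Theta_w U th.1 /\ Bmin < th.2 < U].
Definition pos_orthant : set (d.-tuple R) := [set a | forall i, 0 < tnth a i].

Definition is_pacing (U Bmin : R) (mu : (d.-tuple R * R)%type -> R) :=
  leb_measurable_fun leb_typ (Theta U Bmin) mu /\
  forall th, Theta U Bmin th -> 0 <= mu th.

Variables (n : nat) (U Bmin : R) (F : probability (d.-tuple R) R)
  (G : probability (d.-tuple R * R)%type R) (r : d.-tuple R -> R)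
  (mu : (d.-tuple R * R)%type -> R).

Definition paced (a : d.-tuple R) (th : (d.-tuple R * R)%type) : R :=
  dotp th.1 a / (1 + mu th).

Definition lam_cdf (a : d.-tuple R) (x : R) : R :=
  fine (\int[G]_(th in Theta U Bmin) (\1_[set th | paced a th <= x] th)%:E)%E.

Definition Hcdf (a : d.-tuple R) (x : R) : R := lam_cdf a x ^+ n.-1.

Definition sigma (a : d.-tuple R) (x : R) : R :=
  if x < r a then x
  else if 0 < Hcdf a x then
    x - Rintegral (@lebesgue_measure R) `[r a, x] (fun s => Hcdf a s / Hcdf a x)
  else r a.

Definition beta (th : (d.-tuple R * R)%type) (a : d.-tuple R) : R :=
  sigma a (paced a th).

Definition compet (a : d.-tuple R) (ths : n.-1.-tuple (d.-tuple R * R)%type) : R :=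
  \big[Num.max/r a]_(th <- ths) beta th a.

Definition joint := (F \x iprod G n.-1)%E.

Definition objective (w : d.-tuple R) (b : d.-tuple R -> R) : \bar R :=
  (\int[joint]_(p in setT)
     ((dotp w p.1 - b p.1) * \1_[set p | compet p.1 p.2 <= b p.1] p)%:E)%E.

Definition payment (b : d.-tuple R -> R) : \bar R :=
  (\int[joint]_(p in setT)
     (b p.1 * \1_[set p | compet p.1 p.2 <= b p.1] p)%:E)%E.

Definition feasible (A : set (d.-tuple R)) (B : R) (b : d.-tuple R -> R) :=
  leb_measurable_fun leb_vec A b /\ (forall a, A a -> 0 <= b a) /\
  (payment b <= B%:E)%E.

Definition optimal_Q (A : set (d.-tuple R)) (w : d.-tuple R) (B : R)
    (b : d.-tuple R -> R) :=
  feasible A B b /\ forall b', feasible A B b' -> (objective w b' <= objective w b)%E.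

Definition qdual (w : d.-tuple R) (B t : R) : \bar R :=
  ((1 + t)%:E *
     \int[F]_(a in setT)
       (\1_[set a | r a <= dotp w a / (1 + t)] a *
        Rintegral (@lebesgue_measure R) `[r a, dotp w a / (1 + t)] (Hcdf a))%:E
   + (t * B)%:E)%E.

End defs.

Arguments pos_orthant {R d}.
Arguments leb_vec {R d}.
Arguments leb_typ {R d}.

(* Main.v *)
(** Fix a pacing function mu and write H for the CDF of the highest rival paced
    value of an item, L for that of one rival, so that H = L^(n-1).  If L is
    continuous, the envelope formula for the first-price auction with reserve
    holds: for x = w.a/(1+t), the surplus (x - b) * P(b wins) of any bid b is at
    most the integral I(x) of H from r to x, with equality for b = sigma(x) when
    x <> r; the expected payment is then x H(x) - I(x).  Since I is convex with
    derivative H, B minus the expected payment is a subgradient of the dual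
    function q, and, unless x = r with positive probability, it depends
    continuously on t.  Minimality of t* thus gives feasibility and
    complementary slackness of the bid sigma, and weak duality concludes.

    Both genericity conditions hold almost surely by one argument.  For random
    vectors K and K' that are independent with the same law, and are almost
    surely different, and an independent vector a that charges no hyperplane,
    K.a = K'.a has probability 0 by Fubini, so that for almost every a the law
    of K.a has no atom.  With K = w/(1+mu) this makes L continuous for almost
    every item a; with the roles exchanged and K = a/r it gives, for almost
    every w, that w.a/(1+t) = r(a) has probability 0 for all t.  Only here is
    d >= 2 used: lines through the origin are null.

    Measurability is with respect to completed sigma-algebras, so r, mu and the
    bids are first replaced by Borel functions that agree with them off a null
    set. *)

Require Import Defs.
From HB Require Import structures.
From mathcomp Require Import all_boot all_order all_algebra.
From mathcomp Require Import all_classical all_reals all_analysis.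
From mathcomp Require Import measurable_realfun.
From mathcomp Require Import ring lra.
Set Implicit Arguments. Unset Strict Implicit. Unset Printing Implicit Defensive.
Import Order.TTheory GRing.Theory Num.Theory.
Import numFieldNormedType.Exports.
Local Open Scope classical_set_scope.
Local Open Scope ring_scope.

(** * Null sets and iterated products *)

Section null_sets.
Context {dT : measure_display} {T : measurableType dT} {R : realType}.
Variable mu : {measure set T -> \bar R}.
Local Open Scope ereal_scope.
Import HBNNSimple.

Let nnintegral (f : T -> \bar R) := ereal_sup [set sintegral mu h |
  h in [set h : {nnsfun T >-> R} | forall x, (h x)%:E <= f x]].

(** Multiplying a simple function below [f] by the indicator of the complement of [N] keeps its
    integral and puts it below [g], because [g] is nonnegative on [N]. *)
Let le_nnintegral_off_null (N : set T) (f g : T -> \bar R) :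
  measurable N -> mu N = 0 -> (forall x, 0 <= g x) ->
  (forall x, ~ N x -> f x = g x) -> nnintegral f <= nnintegral g.
Proof.
move=> mN N0 g0 fg; apply: ge_ereal_sup => _ [h /= hf <-].
pose h' := proj_nnsfun h (measurableC mN).
suff -> : sintegral mu h = sintegral mu h'.
  apply: ereal_sup_ubound; exists h' => //= x.
  change ((h x * \1_(~` N) x)%:E <= g x).
  rewrite indicE; have [xN|xN] := boolP (x \in ~` N).
    by rewrite mulr1; move: xN; rewrite inE => /fg <-.
  by rewrite mulr0.
have E (k : {nnsfun T >-> R}) : sintegral mu k = \int[mu]_x (k x)%:E.
  by rewrite integral_nnsfun// patch_setT.
rewrite !E; apply: ae_eq_integral => //.
- exact/measurable_EFinP.
- exact/measurable_EFinP.
exists N; split=> // x /=; apply: contra_notP => Nx _.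
change ((h x)%:E = (h x * \1_(~` N) x)%:E).
by rewrite indicE mem_set ?mulr1.
Qed.

(* No measurability is needed: the library's integral is a supremum over
   simple functions. *)
Lemma eq_integral_off_null (D N : set T) (f g : T -> \bar R) :
  measurable N -> mu N = 0 -> (forall x, D x -> ~ N x -> f x = g x) ->
  \int[mu]_(x in D) f x = \int[mu]_(x in D) g x.
Proof.
move=> mN N0 fg.
have fgD x : ~ N x -> (f \_ D) x = (g \_ D) x.
  move=> Nx; rewrite !patchE; case: ifPn => // /set_mem Dx; exact: fg.
rewrite /integral; congr (_ - _); apply/le_anti/andP; split;
  apply: (le_nnintegral_off_null mN N0) => // x Nx;
  rewrite ?funeposE ?funenegE fgD//.
Qed.

Lemma measure_null_sub (A N : set T) :
  measurable A -> measurable N -> A `<=` N -> mu N = 0 -> mu A = 0.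
Proof.
by move=> mA mN AN N0; apply/eqP; rewrite -measure_le0 -N0 le_measure ?inE.
Qed.

End null_sets.

(** * Iterated products as sigma-finite measures *)

Section iprod_measure.
Context {R : realType} {dT : measure_display} {T : measurableType dT}.
Local Open Scope ereal_scope.

Lemma measurable_cons_tuple k :
  measurable_fun [set: T * k.-tuple T] (fun p => cons_tuple p.1 p.2).
Proof. exact: measurable_cons. Qed.

Lemma iprodS (m : set T -> \bar R) k S : iprod m k.+1 S =
  (m \x iprod m k) ((fun p => cons_tuple p.1 p.2) @^-1` S).
Proof. by []. Qed.

Section cons_product.
Variables (m : {sigma_finite_measure set T -> \bar R}) (k : nat).
Variable M : {sigma_finite_measure set (k.-tuple T) -> \bar R}.
Let c := fun p : T * k.-tuple T => cons_tuple p.1 p.2.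

(** The successor step of [iprod] over an abstract measure [M], so that the measure structure on one
    power can be built from that on the previous one. *)
Definition cons_product (A : set (k.+1.-tuple T)) := (m \x M) (c @^-1` A).

Let mc : measurable_fun setT c. Proof. exact: measurable_cons_tuple. Qed.

Let cons_product0 : cons_product set0 = 0.
Proof. by rewrite /cons_product preimage_set0 measure0. Qed.

Let cons_product_ge0 A : 0 <= cons_product A.
Proof. exact: integral_ge0. Qed.

Let cons_product_sadd : semi_sigma_additive cons_product.
Proof. exact: (@measure_semi_sigma_additive _ _ _ (pushforward (m \x M) c)). Qed.

HB.instance Definition _ := isMeasure.Build _ _ _ cons_product
  cons_product0 cons_product_ge0 cons_product_sadd.

Let cons_product_sf : sigma_finite setT cons_product.
Proof.
have /sigma_finiteP[F [TF ndF Foo]] := sigma_finiteT m.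
have /sigma_finiteP[K [TK ndK Koo]] := sigma_finiteT M.
(* [u] undoes [c], so pulling the rectangles of two exhausting sequences back along [u] gives sets
   whose preimage under [c] is the same rectangle, of finite mass. *)
pose u := fun t : k.+1.-tuple T => (thead t, [tuple of behead t]).
have mu : measurable_fun setT u.
  apply/measurable_fun_pair; first exact: measurable_tnth.
  exact: measurable_behead.
have cu p : u (c p) = p by case: p => a t; congr (_, _); exact/val_inj.
exists (fun n => u @^-1` (F n `*` K n)).
  rewrite -preimage_bigcup -(preimage_setT u) -setXTT TF TK; congr (_ @^-1` _).
  apply/seteqP; split=> [[x y] [[i _ Fx] [j _ Ky]]|[x y] [i _ []]].
    exists (maxn i j) => //; split.
      by move: Fx => {Ky}; move: x; exact/subsetPset/ndF/leq_maxl.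
    by move: Ky => {Fx}; move: y; exact/subsetPset/ndK/leq_maxr.
  by split; exists i.
move=> n; have [mF Fn] := Foo n; have [mK Kn] := Koo n; split.
  by rewrite -[X in measurable X]setTI; apply: mu => //; exact: measurableX.
rewrite /cons_product (_ : c @^-1` _ = F n `*` K n).
  by rewrite product_measure1E// lte_mul_pinfty// ge0_fin_numE.
by rewrite -comp_preimage (_ : u \o c = id)//; exact/funext.
Qed.

HB.instance Definition _ := Measure_isSigmaFinite.Build _ _ _ cons_product
  cons_product_sf.

End cons_product.

(** Sigma-finiteness has to travel with the induction, since forming the next product measure uses
    it. The structures on [iprod] itself are then read off [M]. *)
Lemma iprod_sigma_finite_ex (m : {sigma_finite_measure set T -> \bar R}) k :
  exists M : {sigma_finite_measure set (k.-tuple T) -> \bar R},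
    iprod m k = M :> (set (k.-tuple T) -> \bar R).
Proof.
elim: k => [|k [M IH]].
  by exists (@dirac _ _ [tuple] R).
by exists (cons_product m M); apply/funext => S; rewrite iprodS IH.
Qed.

Section instances.
Variables (m : {sigma_finite_measure set T -> \bar R}) (k : nat).

Let iprod_0 : iprod m k set0 = 0.
Proof. by have [M ->] := iprod_sigma_finite_ex m k; exact: measure0. Qed.

Let iprod_ge0 A : 0 <= iprod m k A.
Proof. by have [M ->] := iprod_sigma_finite_ex m k; exact: measure_ge0. Qed.

Let iprod_sadd : semi_sigma_additive (iprod m k).
Proof.
have [M ->] := iprod_sigma_finite_ex m k; exact: measure_semi_sigma_additive.
Qed.

HB.instance Definition _ := isMeasure.Build _ _ _ (iprod m k)
  iprod_0 iprod_ge0 iprod_sadd.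

Let iprod_sf : sigma_finite setT (iprod m k).
Proof. by have [M ->] := iprod_sigma_finite_ex m k; exact: sigma_finiteT. Qed.

HB.instance Definition _ := Measure_isSigmaFinite.Build _ _ _ (iprod m k)
  iprod_sf.

End instances.

(** Independence of the draws: one coordinate at a time, the box splits off a factor. This turns the
    event that every rival stays below a bid into a power. *)
Lemma iprod_box (m : {sigma_finite_measure set T -> \bar R}) k (S : set T) :
  measurable S ->
  iprod m k [set t | forall i, S (tnth t i)] = m S ^+ k.
Proof.
move=> mS; elim: k => [|k IH].
  by rewrite /= indicE mem_set// => -[].
rewrite iprodS (_ : _ @^-1` _ = S `*` [set t | forall i, S (tnth t i)]).
  rewrite expeS -IH; apply: product_measure1E => //.
  rewrite (_ : [set t | _] = \bigcap_(i in [set: 'I_k]) ((@tnth k T)^~ i @^-1` S)).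
    apply: fin_bigcap_measurable => // i _.
    by rewrite -[X in measurable X]setTI; exact: measurable_tnth.
  by apply/seteqP; split=> t /= h i; [move=> _|]; exact: h.
apply/seteqP; split=> -[a t] /= h.
  split=> [|i]; first exact: (h ord0).
  by have := h (lift ord0 i); rewrite tnthS.
by move=> i; case: (unliftP ord0 i) => [j ->|->]; rewrite ?tnthS; [exact: h.2|exact: h.1].
Qed.

End iprod_measure.

Section iprod_probability.
Context {R : realType} {dT : measure_display} {T : measurableType dT}.
Variables (P : probability T R) (k : nat).

Let iprod_setT : iprod P k setT = 1%E.
Proof.
have PT : P setT = 1%E := probability_setT P.
have <- : (P setT ^+ k)%E = 1%E by rewrite PT; elim: k => [|j IH]; rewrite ?expe0 ?expeS ?IH ?mule1.
rewrite -(iprod_box P k measurableT); congr (iprod _ _ _).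
by apply/seteqP; split.
Qed.

HB.instance Definition _ := Measure_isProbability.Build _ _ _ (iprod P k)
  iprod_setT.

End iprod_probability.

(** * Hyperplanes *)

Section dotp_theory.
Context {R : realType} {dX : measure_display} {X : measurableType dX} {d : nat}.

Lemma measurable_dotp (f g : X -> d.-tuple R) :
  measurable_fun setT f -> measurable_fun setT g ->
  measurable_fun setT (fun x => dotp (f x) (g x)).
Proof.
move=> mf mg; apply: measurable_sum => i; apply: measurable_funM.
- by move/measurable_fun_tnthP : mf => /(_ i).
- by move/measurable_fun_tnthP : mg => /(_ i).
Qed.

Definition subt (u v : d.-tuple R) : d.-tuple R :=
  [tuple tnth u i - tnth v i | i < d].

Definition scalet (k : R) (u : d.-tuple R) : d.-tuple R :=
  [tuple k * tnth u i | i < d].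

Lemma dotpC (u v : d.-tuple R) : dotp u v = dotp v u.
Proof. by apply: eq_bigr => i _; rewrite mulrC. Qed.

Lemma dotp_subl (u v a : d.-tuple R) : dotp (subt u v) a = dotp u a - dotp v a.
Proof. by rewrite /dotp -sumrB; apply: eq_bigr => i _; rewrite tnth_mktuple mulrBl. Qed.

Lemma dotp_scalel k (u a : d.-tuple R) : dotp (scalet k u) a = k * dotp u a.
Proof. by rewrite /dotp mulr_sumr; apply: eq_bigr => i _; rewrite tnth_mktuple mulrA. Qed.

Lemma subt_neq0 (u v : d.-tuple R) : u <> v -> exists i, tnth (subt u v) i != 0.
Proof.
move=> uv; apply/existsP; rewrite -negb_forall; apply/negP => /forallP h.
apply: uv; apply: eq_from_tnth => i; apply/eqP.
by rewrite -subr_eq0; have := h i; rewrite tnth_mktuple.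
Qed.

(** If the first coordinate of [v] vanishes, the first basis vector will do; otherwise the first two
    coordinates are rotated by a right angle and the others set to 0. *)
Lemma exists_orthogonal (v : d.-tuple R) : (2 <= d)%N ->
  exists c : d.-tuple R, (exists i, tnth c i != 0) /\ dotp c v = 0.
Proof.
move=> d2; have d0 : (0 < d)%N by exact: ltnW.
pose i0 := Ordinal d0; pose i1 := Ordinal d2.
have i01 : i1 != i0 by [].
have i10 : i0 != i1 by [].
have [v0|v0] := eqVneq (tnth v i0) 0.
  exists [tuple (i == i0)%:R | i < d]; split.
    by exists i0; rewrite tnth_mktuple eqxx oner_eq0.
  rewrite /dotp (bigD1 i0)//= big1 ?addr0 ?tnth_mktuple ?v0 ?mulr0//.
  by move=> i /negbTE ii; rewrite tnth_mktuple ii mul0r.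
exists [tuple (i == i0)%:R * - tnth v i1 + (i == i1)%:R * tnth v i0 | i < d]; split.
  by exists i1; rewrite tnth_mktuple eqxx (negbTE i01) mul0r add0r mul1r.
rewrite /dotp (bigD1 i0)//= (bigD1 i1)//= big1 ?addr0; last first.
  by move=> i /andP[/negbTE ii /negbTE ij]; rewrite tnth_mktuple ii ij !mul0r addr0 mul0r.
by rewrite !tnth_mktuple !eqxx (negbTE i01) (negbTE i10) /=; ring.
Qed.

End dotp_theory.

(* The tuple types of [leb_vec] and of the distributions carry measurable
   structures on [R] that agree only on their measurable sets, so the measure
   structures have to be rebuilt. *)
Section lebesgue_instances.
Context {R : realType} (d : nat).
Local Open Scope ereal_scope.
Local Notation vec := (@leb_vec R d).
Local Notation typ := (@leb_typ R d).

Let leb_vec0 : vec set0 = 0.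
Proof. exact: (measure0 (iprod (@lebesgue_measure R) d)). Qed.

Let leb_vec_ge0 A : 0 <= vec A.
Proof. exact: (measure_ge0 (iprod (@lebesgue_measure R) d)). Qed.

Let leb_vec_sadd : semi_sigma_additive (vec : set (d.-tuple R) -> _).
Proof.
exact: (@measure_semi_sigma_additive _ _ _ (iprod (@lebesgue_measure R) d)).
Qed.

HB.instance Definition _ := isMeasure.Build _ (d.-tuple R)%type R vec
  leb_vec0 leb_vec_ge0 leb_vec_sadd.

Let leb_typ0 : typ set0 = 0.
Proof. exact: (measure0 (vec \x @lebesgue_measure R)). Qed.

Let leb_typ_ge0 A : 0 <= typ A.
Proof. exact: (measure_ge0 (vec \x @lebesgue_measure R)). Qed.

Let leb_typ_sadd : semi_sigma_additive (typ : set (d.-tuple R * R)%type -> _).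
Proof.
exact: (@measure_semi_sigma_additive _ _ _ (vec \x @lebesgue_measure R)).
Qed.

HB.instance Definition _ := isMeasure.Build _ (d.-tuple R * R)%type R typ
  leb_typ0 leb_typ_ge0 leb_typ_sadd.

End lebesgue_instances.

Section density.
Context {R : realType}.
Local Open Scope ereal_scope.

Lemma density_null {dT} (T : measurableType dT) (P : probability T R)
    (m : {measure set T -> \bar R}) (S : set T) :
  has_density m P -> measurable S -> m S = 0 -> P S = 0.
Proof.
move=> [f [mf [f0 Pf]]] mS S0; rewrite Pf//; apply: null_set_integral => //.
exact/measurable_EFinP/measurable_funTS.
Qed.

(** Induction on the dimension, slicing along the first coordinate. If a later coefficient is
    nonzero, every slice is an affine hyperplane, whence the general [k]; otherwise only the slice
    at [k / c ord0] is nonempty, and a point is null. *)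
Lemma leb_vec_hyperplane d (c : 'I_d -> R) (k : R) : (exists i, c i != 0%R) ->
  leb_vec [set a : d.-tuple R | \sum_(i < d) c i * tnth a i = k]%R = 0.
Proof.
rewrite /leb_vec; elim: d c k => [|d IH] c k [i ci]; first by case: i ci.
rewrite iprodS /product_measure1.
set A := _ @^-1` _.
have xA x : xsection A x =
    [set a | \sum_(i < d) c (lift ord0 i) * tnth a i = k - c ord0 * x]%R.
  apply/seteqP; split=> t; rewrite /xsection /A /= inE /= big_ord_recl.
    move=> <-; rewrite /= (_ : tnth _ ord0 = x)// addrC addKr.
    by apply: eq_bigr => j _; rewrite tnthS.
  move=> h; rewrite (_ : tnth _ ord0 = x)//.
  rewrite (eq_bigr (fun i => c (lift ord0 i) * tnth t i))%R; last first.
    by move=> j _; rewrite tnthS.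
  by rewrite h addrC subrK.
have [[j cj]|nc] := pselect (exists j, c (lift ord0 j) != 0%R).
  by apply: integral0_eq => x _ /=; rewrite xA; apply: IH; exists j.
have c0 : c ord0 != 0%R.
  by case: (unliftP ord0 i) ci => [j ->|-> //] cj; case: nc; exists j.
transitivity (\int[@lebesgue_measure R]_x cst 0 x); last exact: integral0.
apply: (@eq_integral_off_null _ _ _ (@lebesgue_measure R) setT [set (k / c ord0)%R]) => //.
  exact: lebesgue_measure_set1.
move=> x _ /= xk; rewrite xA (_ : [set a | _] = set0) ?measure0//.
rewrite -subset0 => t /=; rewrite big1 => [/esym/eqP|j _]; last first.
  have -> : c (lift ord0 j) = 0%R by apply/eqP/negPn/negP => cj; apply: nc; exists j.
  by rewrite mul0r.
rewrite subr_eq0 => /eqP kx; apply: xk.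
by rewrite kx mulrAC mulfV// mul1r.
Qed.


End density.

(** * Borel representatives and atoms *)

Section measurable_sets.
Context {dX : measure_display} {X : measurableType dX} {R : realType}.

Lemma measurable_le_set (f g : X -> R) : measurable_fun setT f ->
  measurable_fun setT g -> measurable [set x | f x <= g x].
Proof.
move=> mf mg; rewrite -[X in measurable X]setTI; exact: measurable_fun_le.
Qed.

Lemma measurable_lt_set (f g : X -> R) : measurable_fun setT f ->
  measurable_fun setT g -> measurable [set x | f x < g x].
Proof.
move=> mf mg; rewrite (_ : [set x | _] = ~` [set x | g x <= f x]).
  by apply: measurableC; exact: measurable_le_set.
by apply/seteqP; split=> x /=; rewrite ltNge => /negP.
Qed.

Lemma measurable_eq_set (f g : X -> R) : measurable_fun setT f ->
  measurable_fun setT g -> measurable [set x | f x = g x].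
Proof.
move=> mf mg; rewrite (_ : [set x | _] =
    [set x | f x <= g x] `&` [set x | g x <= f x]).
  by apply: measurableI; exact: measurable_le_set.
apply/seteqP; split=> x /=; first by move=> ->.
by move=> [fg gf]; apply/le_anti/andP.
Qed.

Lemma measurable_fun_le_set (f : X -> R) :
  (forall y, measurable [set x | f x <= y]) -> measurable_fun setT f.
Proof.
move=> mf; apply: (measurability (@RGenOInfty.G R)) => [|/= _ [_] [r] -> <-].
  exact: RGenOInfty.measurableE.
rewrite setTI (_ : f @^-1` _ = ~` [set x | f x <= r]).
  exact/measurableC/mf.
by apply/seteqP; split=> x /=; rewrite in_itv/= andbT ltNge => /negP.
Qed.

Lemma measurable_fun_inv_pos (f : X -> R) : (forall x, 0 < f x) ->
  measurable_fun setT f -> measurable_fun setT (fun x => (f x)^-1).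
Proof.
move=> f0 mf; apply: measurable_fun_le_set => y.
rewrite (_ : [set x | _] = [set x | 1 <= y * f x]).
  apply: measurable_le_set => //; exact: measurable_funM.
by apply/seteqP; split=> x /=; rewrite -(ler_pdivrMr _ _ (f0 x)) mul1r.
Qed.

End measurable_sets.

Section borel_version.
Context {dT : measure_display} {T : measurableType dT} {R : realType}.
Variable m : {measure set T -> \bar R}.

(** [f x] is the infimum of the rationals [q] with [f x <= q]. Each of these countably many sublevel
    sets is Borel up to a null set, and [g] is the infimum formed with the Borel sets. *)
Lemma leb_measurable_fun_borel (D : set T) (f : T -> R) :
  leb_measurable_fun m D f ->
  exists g N, [/\ measurable_fun setT g, measurable N, m N = 0%E &
    forall x, D x -> ~ N x -> f x = g x].
Proof.
move=> Df.
have {Df} /choice[BN BNP] : forall k : nat, exists BN : set T * set T,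
    [/\ measurable BN.1, measurable BN.2, m BN.2 = 0%E &
     forall q : rat, unpickle k = Some q -> forall x, D x -> ~ BN.2 x ->
       (f x <= ratr q) <-> BN.1 x].
  move=> k; case: (unpickle k) => [q|]; last first.
    by exists (set0, set0); split=> //=; exact: measure0.
  have [L [[B [N [mB [mN [N0 LBN]]]]] DL]] := Df _ (measurable_itv `]-oo, ratr q]).
  exists (B, N); split=> //= _ [<-] x Dx Nx.
  have -> : (f x <= ratr q) <-> (D `&` L) x.
    by rewrite -DL /= in_itv/=; split=> [|[]].
  split=> [[_ Lx]|Bx].
    by apply: contrapT => Bx; apply/Nx/LBN; left.
  by split=> //; apply: contrapT => Lx; apply/Nx/LBN; right.
(* Indices that code no rational, or a rational whose Borel set misses [x], count as [+oo] and do
   not affect the infimum. *)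
pose h k x := if unpickle k is Some q then
  (if x \in (BN k).1 then (ratr q : R)%:E else +oo%E) else +oo%E.
pose g x := fine (einfs (h ^~ x) 0%N).
exists g, (\bigcup_k (BN k).2); split.
- apply: measurableT_comp => //; apply: measurable_fun_einfs => k.
  rewrite /h; case: (unpickle k) => [q|//].
  apply: measurable_fun_ifT => //; apply: (measurable_fun_bool true).
  rewrite setTI (_ : _ @^-1` _ = (BN k).1); first by have [] := BNP k.
  by apply/seteqP; split=> x /=; [move=> /set_mem|move=> /mem_set ->].
- by apply: bigcupT_measurable => k; have [] := BNP k.
- apply/negligibleP; last apply: negligible_bigcup => k.
    by apply: bigcupT_measurable => k; have [] := BNP k.
  by apply/negligibleP; have [] := BNP k.
move=> x Dx Nx; rewrite /g.
suff -> : einfs (h ^~ x) 0%N = (f x)%:E by [].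
have P k q : unpickle k = Some q -> (f x <= ratr q) <-> (BN k).1 x.
  by move=> kq; have [_ _ _ ->] := BNP k => // Nkx; apply: Nx; exists k.
apply/le_anti/andP; split.
  apply/lee_addgt0Pr => e e0.
  have /rat_in_itvoo[q] : f x < f x + e by rewrite ltrDl.
  rewrite in_itv /= => /andP[fq qe].
  apply: (@le_trans _ _ (ratr q)%:E); last by rewrite -EFinD lee_fin ltW.
  apply: ereal_inf_lbound; exists (pickle q) => //=.
  rewrite /h pickleK mem_set//.
  by apply: (P _ _ (pickleK q)).1; exact: ltW.
apply: le_ereal_inf_tmp => _ [k _ <-]; rewrite /h.
case kq: (unpickle k) => [q|]; last by rewrite leey.
case: ifPn => [/set_mem|]; last by rewrite leey.
by move/(P _ _ kq).2; rewrite lee_fin.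
Qed.

End borel_version.

Section no_atoms.
Context {dX dY : measure_display} {X : measurableType dX} {Y : measurableType dY}.
Context {R : realType} {d : nat}.
Variables (P : probability X R) (Q : probability Y R).
Variables (K : X -> d.-tuple R) (g : Y -> d.-tuple R).
Hypotheses (mK : measurable_fun setT K) (mg : measurable_fun setT g).
Hypothesis hyperplane0 : forall c : d.-tuple R, (exists i, tnth c i != 0) ->
  Q [set y | dotp c (g y) = 0] = 0%E.
Hypothesis fiber0 : forall x, P [set x' | K x' = K x] = 0%E.

(** The set [S] collects the ties between two independent draws [x], [x'] as seen from [y]. It is
    null for the triple product, and an atom for [y] would give its section at [y] positive mass. *)
Lemma ae_no_atom : exists N, [/\ measurable N, Q N = 0%E &
  forall y, ~ N y -> forall c, P [set x | dotp (K x) (g y) = c] = 0%E].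
Proof.
pose S := [set p : Y * (X * X) |
  dotp (K p.2.1) (g p.1) = dotp (K p.2.2) (g p.1)].
have mg1 : measurable_fun setT (fun p : Y * (X * X) => g p.1).
  exact: measurableT_comp.
have mK1 : measurable_fun setT (fun p : Y * (X * X) => K p.2.1).
  apply: measurableT_comp => //; exact: measurableT_comp.
have mK2 : measurable_fun setT (fun p : Y * (X * X) => K p.2.2).
  apply: measurableT_comp => //; exact: measurableT_comp.
have mS : measurable S.
  by apply: measurable_eq_set; apply: measurable_dotp.
pose E := [set p : X * X | K p.1 = K p.2].
have mE : measurable E.
  rewrite (_ : E = \bigcap_(i in [set: 'I_d])
      [set p : X * X | tnth (K p.1) i = tnth (K p.2) i]).
    apply: fin_bigcap_measurable => // i _; apply: measurable_eq_set.
      apply: (measurableT_comp (measurable_tnth i)).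
      exact: measurableT_comp.
    apply: (measurableT_comp (measurable_tnth i)).
    exact: measurableT_comp.
  apply/seteqP; split=> p /=; first by move=> Ep i _ /=; rewrite Ep.
  by move=> h; apply: eq_from_tnth => i; exact: h.
have PE : (P \x P)%E E = 0%E.
  apply: integral0_eq => x _ /=; rewrite -[RHS](fiber0 x); congr (P _).
  by apply/seteqP; split=> x'; rewrite /xsection /E /= inE.
pose PP : probability (X * X)%type R := (P \x P)%E.
pose h y := PP (xsection S y).
have mh : measurable_fun setT h by exact: (measurable_fun_xsection PP mS).
have h0 y : (0 <= h y)%E by exact: measure_ge0.
(* Tonelli: for a fixed pair off the diagonal event [E], the [y] that produce a tie form a
   hyperplane with normal [K x - K x']. *)
have Ih : (\int[Q]_y h y = 0)%E.
  have := indic_fubini_tonelli Q PP mS.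
  rewrite indic_fubini_tonelli_FE// indic_fubini_tonelli_GE// => ->.
  transitivity (\int[PP]_y cst 0 y)%E; last exact: integral0.
  apply: (eq_integral_off_null mE PE) => -[x x'] _ /= nE.
  rewrite -[RHS](hyperplane0 (subt_neq0 nE)); congr (Q _).
  apply/seteqP; split=> y; rewrite /ysection /S /= inE /= dotp_subl.
    by move=> ->; rewrite subrr.
  by move/eqP; rewrite subr_eq0 => /eqP.
pose N := [set y | h y != 0%E].
have mN : measurable N.
  rewrite -[X in measurable X]setTI; exact: emeasurable_neq.
exists N; split=> //.
  have /ae_eq_integral_abs : measurable_fun setT h by [].
  move=> /(_ Q measurableT)[+ _].
  have -> : (\int[Q]_x `|h x| = \int[Q]_x h x)%E.
    by apply: eq_integral => y _; rewrite gee0_abs.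
  move=> /(_ Ih) [N' [mN' N'0 hN']].
  apply: (measure_null_sub mN mN' _ N'0) => y /= hy; apply: hN' => /=.
  by apply/not_implyP; split=> //; apply/eqP.
move=> y /negP/negPn/eqP hy c.
set Sc := [set x | _].
have mSc : measurable Sc.
  apply: measurable_eq_set => //; apply: measurable_dotp => //.
(* Any two draws in the same atom tie, so the square of the atom lies in the null section. *)
have SS : (P \x P)%E (Sc `*` Sc) = 0%E.
  apply: (measure_null_sub _ _ _ hy).
  - exact: measurableX.
  - exact: measurable_xsection.
  by move=> [x x'] [/= Sx Sx']; rewrite /xsection /= inE /S /= Sx.
move: SS; rewrite product_measure1E// => /eqP.
by rewrite mule_eq0 orbb => /eqP.
Qed.

End no_atoms.

(** * The auction for a single item *)

Section monotone_primitive.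
Context {R : realType}.
Variable H : R -> R.
Hypotheses (H_nd : {homo H : x y / x <= y}) (H01 : forall x, 0 <= H x <= 1).
Implicit Types r x y z : R.
Local Notation leb := (@lebesgue_measure R).

Let H_ge0 x : 0 <= H x. Proof. by case/andP: (H01 x). Qed.
Let H_le1 x : H x <= 1. Proof. by case/andP: (H01 x). Qed.

Definition primitive r x := Rintegral leb `[r, x] H.

Lemma nd_integrable x y : leb.-integrable `[x, y] (EFin \o H).
Proof.
have fin : (leb `[x, y] < +oo)%E.
  by rewrite lebesgue_measure_itv/=; case: ifPn => // _; rewrite -EFinB ltry.
apply: measurable_bounded_integrable => //.
- exact: nondecreasing_measurable.
- exists 1; split; first exact: num_real.
  by move=> M M1 z _ /=; rewrite ger0_norm//; exact: le_trans (ltW M1).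
Qed.

Lemma primitive_lt r x : x < r -> primitive r x = 0.
Proof. by move=> xr; rewrite /primitive set_itv_ge ?Rintegral_set0// bnd_simp -ltNge. Qed.

Lemma primitive_ge0 r x : 0 <= primitive r x.
Proof. by apply: Rintegral_ge0 => *. Qed.

Lemma primitive_bounds r x y : r <= x -> x <= y ->
  (y - x) * H x <= primitive r y - primitive r x <= (y - x) * H y.
Proof.
move=> rx xy.
have -> : primitive r y - primitive r x = Rintegral leb `]x, y] H.
  by apply: Rintegral_itvB; [exact: nd_integrable|rewrite bnd_simp..].
have xyE c : Rintegral leb `]x, y] (fun=> c) = (y - x) * c.
  transitivity (c * fine (leb `]x, y])); first exact: Rintegral_cst.
  rewrite lebesgue_measure_itv/= lte_fin mulrC.
  move: xy; rewrite le_eqVlt => /predU1P[->|->//].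
  by rewrite ltxx subrr.
have iH : leb.-integrable `]x, y] (EFin \o H).
  apply: (integrableS _ _ _ (nd_integrable x y)) => //.
  by apply: subset_itvr; rewrite bnd_simp.
have ic (c : R) : leb.-integrable `]x, y] (EFin \o cst c).
  have fin : (leb `]x, y] < +oo)%E.
    by rewrite lebesgue_measure_itv/=; case: ifPn => // _; rewrite -EFinB ltry.
  apply: measurable_bounded_integrable => //.
  exists `|c|; split; first exact: num_real.
  by move=> M /ltW cM z _ /=.
rewrite -!xyE; apply/andP; split; apply: le_Rintegral => //.
- exact: ic.
- by move=> z; rewrite /= in_itv/= => /andP[xz zy]; apply/H_nd/ltW.
- exact: ic.
- by move=> z; rewrite /= in_itv/= => /andP[xz zy]; apply/H_nd.
Qed.

Lemma primitiverr r : primitive r r = 0.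
Proof. by rewrite /primitive set_itv1 Rintegral_set1. Qed.

Lemma primitive_le_mul r x : r <= x -> primitive r x <= (x - r) * H x.
Proof.
by move=> rx; have := primitive_bounds (lexx r) rx; rewrite primitiverr subr0 => /andP[].
Qed.

(** The jump at [r] is the reason why paced values equal to the reserve have to be excluded
    later. *)
Definition cutoff r x := if r <= x then H x else 0.

(* [primitive r] is convex with subgradient [cutoff r]. *)
Lemma primitive_tangent r x y :
  (y - x) * cutoff r x + primitive r x <= primitive r y.
Proof.
rewrite /cutoff; have [rx|xr] := leP r x; last first.
  by rewrite mulr0 add0r primitive_lt// primitive_ge0.
have [ry|yr] := leP r y.
  have [xy|/ltW yx] := leP x y.
    by have /andP[+ _] := primitive_bounds rx xy; lra.
  by have /andP[_] := primitive_bounds ry yx; lra.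
rewrite (primitive_lt yr); have := primitive_le_mul rx.
have := mulr_ge0 _ (H_ge0 x) (x := r - y); rewrite subr_ge0 => /(_ (ltW yr)).
lra.
Qed.

Lemma primitive_lip r x y : x <= y -> 0 <= primitive r y - primitive r x <= y - x.
Proof.
move=> xy; have [rx|xr] := leP r x.
  have /andP[h1 h2] := primitive_bounds rx xy.
  have h3 : 0 <= (y - x) * H x by rewrite mulr_ge0// subr_ge0.
  have h4 : (y - x) * H y <= y - x by rewrite ler_piMr// subr_ge0.
  by apply/andP; split; lra.
rewrite (primitive_lt xr) subr0 primitive_ge0/=.
have [ry|yr] := leP r y; last by rewrite primitive_lt// subr_ge0.
have := primitive_le_mul ry.
have : (y - r) * H y <= y - r by rewrite ler_piMr// subr_ge0.
lra.
Qed.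

(** The formula of [sigma] with the CDF as a parameter, so that the analysis of bids is free of the
    model; [sigmaE] links the two. *)
Definition bid r x :=
  if x < r then x
  else if 0 < H x then x - Rintegral leb `[r, x] (fun s => H s / H x)
  else r.

Lemma bid_lt r x : x < r -> bid r x = x.
Proof. by rewrite /bid => ->. Qed.

Lemma bid_pos r x : r <= x -> 0 < H x -> bid r x = x - primitive r x / H x.
Proof.
move=> rx H0; rewrite /bid ltNge rx H0 /=; congr (_ - _).
by rewrite RintegralZr//; exact: nd_integrable.
Qed.

Lemma bid_H0 r x : r <= x -> H x = 0 -> bid r x = r.
Proof. by move=> rx H0; rewrite /bid ltNge rx /= H0 ltxx. Qed.

Lemma H_eq0_or_gt0 x : H x = 0 \/ 0 < H x.
Proof. by have := H_ge0 x; rewrite le_eqVlt => /predU1P[|]; [left|right]. Qed.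

(** Where [H x] vanishes the primitive does too, being at most [(x - r) * H x]; so the convention
    for [H x = 0] costs nothing here. *)
Lemma bid_mulH r x : r <= x -> bid r x * H x = x * H x - primitive r x.
Proof.
move=> rx; have [H0|H0] := H_eq0_or_gt0 x.
  rewrite H0 !mulr0; have := primitive_le_mul rx; have := primitive_ge0 r x.
  by rewrite H0; lra.
by rewrite bid_pos// mulrBl divfK ?gt_eqF.
Qed.

Lemma bid_ge r x : r <= x -> r <= bid r x.
Proof.
move=> rx; have [H0|H0] := H_eq0_or_gt0 x; first by rewrite bid_H0.
rewrite bid_pos//; have := primitive_le_mul rx; rewrite -ler_pdivrMr//; lra.
Qed.

Lemma bid_le r x : r <= x -> bid r x <= x.
Proof.
move=> rx; have [H0|H0] := H_eq0_or_gt0 x; first by rewrite bid_H0.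
by rewrite bid_pos// gerBl divr_ge0 ?primitive_ge0// ltW.
Qed.

(** The quotient of the primitive by [H] grows by at most [y - x]: the old area is divided by a
    larger [H], and the new area is at most [(y - x) * H y]. *)
Lemma bid_nd r : {homo bid r : x y / x <= y}.
Proof.
move=> x y xy; have [rx|xr] := leP r x; last first.
  rewrite bid_lt//; have [ry|yr] := leP r y; last by rewrite bid_lt.
  by apply: (le_trans (ltW xr)); exact: bid_ge.
have ry := le_trans rx xy.
have [Hx|Hx] := H_eq0_or_gt0 x; first by rewrite bid_H0// bid_ge.
have Hy : 0 < H y by exact: lt_le_trans (H_nd xy).
rewrite !bid_pos//.
have /andP[_ h] := primitive_bounds rx xy.
have h1 : primitive r x / H y <= primitive r x / H x.
  by rewrite ler_wpM2l ?primitive_ge0// lef_pV2// H_nd.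
have : (primitive r y - primitive r x) / H y <= y - x by rewrite ler_pdivrMr.
rewrite mulrBl; lra.
Qed.

(** A bidder of value [x] who imitates [z] gains [(x - z) * H z + primitive r z], the value at [x]
    of the tangent to the primitive at [z]; convexity concludes. *)
Lemma bid_deviation r x z b : r <= z -> bid r z <= b ->
  (x - b) * H z <= primitive r x.
Proof.
move=> rz zb; have := primitive_tangent r z x; rewrite /cutoff rz.
have := bid_mulH rz; have := ler_wpM2r (H_ge0 z) zb.
rewrite !mulrBl; lra.
Qed.

End monotone_primitive.

(** * Continuity of the CDF of an atomless law *)

Section continuous_cdf.
Context {dX : measure_display} {X : measurableType dX} {R : realType}.
Variables (P : probability X R) (y : X -> R).
Hypothesis my : measurable_fun setT y.

Definition cdf_of x := fine (P [set t | y t <= x]).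

Let mle x : measurable [set t | y t <= x].
Proof. exact: measurable_le_set. Qed.

Lemma fine_prob_le (S S' : set X) : measurable S -> measurable S' ->
  S `<=` S' -> fine (P S) <= fine (P S').
Proof. by move=> mS mS' SS'; rewrite fine_le ?fin_num_measure// le_measure ?inE. Qed.

Lemma fine_prob01 (S : set X) : measurable S -> 0 <= fine (P S) <= 1.
Proof.
move=> mS; rewrite fine_ge0//=.
by rewrite -lee_fin fineK ?fin_num_measure// probability_le1.
Qed.

Lemma cdf_of_nd : {homo cdf_of : x z / x <= z}.
Proof. by move=> x z xz; apply: fine_prob_le => // t /= /le_trans; exact. Qed.

Lemma cdf_of01 x : 0 <= cdf_of x <= 1.
Proof. exact: fine_prob01. Qed.

Lemma cvg_cdf_of_ndS (u : R^nat) (S : set X) : nondecreasing_seq u ->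
  \bigcup_j [set t | y t <= u j] = S -> cdf_of (u j) @[j --> \oo] --> fine (P S).
Proof.
move=> ndu <-; apply: fine_cvg; rewrite fineK; last first.
  by rewrite fin_num_measure//; exact: bigcupT_measurable.
apply: (nondecreasing_cvg_mu (F := fun j => [set t | y t <= u j])) => //.
  exact: bigcupT_measurable.
move=> i j ij; apply/subsetPset => t /= /le_trans; apply; exact: ndu.
Qed.

Hypothesis atomless : forall c, P [set t | y t = c] = 0%E.

Lemma prob_ltE x : fine (P [set t | y t < x]) = cdf_of x.
Proof.
rewrite /cdf_of (_ : [set t | y t <= x] = [set t | y t < x] `|` [set t | y t = x]).
  have mlt : measurable [set t | y t < x].
    rewrite (_ : [set t | _] = ~` [set t | x <= y t]).
      by apply: measurableC; exact: measurable_le_set.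
    by apply/seteqP; split=> t /=; rewrite ltNge => /negP.
  rewrite measureU//= ?atomless ?adde0//.
    exact: measurable_eq_set.
  by rewrite -subset0 => t [/= tx E]; move: tx; rewrite E ltxx.
apply/seteqP; split=> t /=; rewrite le_eqVlt.
  by move=> /predU1P[|]; [right|left].
by case=> h; rewrite h ?orbT ?eqxx.
Qed.

Lemma cdf_of_left x : cdf_of (x - j.+1%:R^-1) @[j --> \oo] --> cdf_of x.
Proof.
rewrite -prob_ltE; apply: cvg_cdf_of_ndS.
  by move=> i j ij; rewrite lerB// lef_pV2 ?posrE// ler_nat.
apply/seteqP; split=> [t [j _ /=]|t /= tx].
  by move=> /le_lt_trans; apply; rewrite gtrBl.
have : 0 < x - y t by rewrite subr_gt0.
move=> /ltr_add_invr[j]; rewrite add0r => jx; exists j => //=.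
by rewrite lerBrDr addrC -lerBrDr ltW.
Qed.

Lemma cdf_of_right x : cdf_of (x + j.+1%:R^-1) @[j --> \oo] --> cdf_of x.
Proof.
rewrite {2}/cdf_of; apply: fine_cvg; rewrite fineK ?fin_num_measure//.
rewrite (_ : [set t | y t <= x] = \bigcap_j [set t | y t <= x + j.+1%:R^-1]).
  apply: (nonincreasing_cvg_mu (F := fun j => [set t | y t <= x + j.+1%:R^-1])) => //.
  - by rewrite -ge0_fin_numE// fin_num_measure.
  - exact: bigcapT_measurable.
  move=> i j ij; apply/subsetPset => t /= /le_trans; apply.
  by rewrite lerD2l lef_pV2 ?posrE// ler_nat.
apply/seteqP; split=> t /=.
  by move=> tx j _ /=; rewrite (le_trans tx)// lerDl.
move=> h; rewrite leNgt; apply/negP => xt.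
have : 0 < y t - x by rewrite subr_gt0.
move=> /ltr_add_invr[j]; rewrite add0r => jx.
have := h j I => /=; rewrite addrC -lerBlDr => /(lt_le_trans jx).
by rewrite ltxx.
Qed.

(** By monotonicity, one term of each one-sided sequence traps the values on a whole
    neighbourhood. *)
Lemma continuous_cdf_of : continuous cdf_of.
Proof.
move=> x; apply/cvgrPdist_lt => e e0.
have /cvgrPdist_lt/(_ _ e0)[i _ /(_ i (leqnn _)) /= hi] := @cdf_of_left x.
have /cvgrPdist_lt/(_ _ e0)[j _ /(_ j (leqnn _)) /= hj] := @cdf_of_right x.
near=> z.
have zl : x - i.+1%:R^-1 <= z.
  by near: z; apply: (cvgr_ge (f := id)); [exact: cvg_id|rewrite gtrBl].
have zr : z <= x + j.+1%:R^-1.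
  by near: z; apply: (cvgr_le (f := id)); [exact: cvg_id|rewrite ltrDl].
have := cdf_of_nd zl; have := cdf_of_nd zr.
move: hi hj; rewrite !ltr_norml => /andP[? ?] /andP[? ?] ? ?.
by apply/andP; split; lra.
Unshelve. all: by end_near. Qed.

End continuous_cdf.

(** * Best replies and payments against [k] independent rivals *)

Section auction.
Context {dX : measure_display} {X : measurableType dX} {R : realType}.
Variables (P : probability X R) (y : X -> R) (k : nat) (r : R).
Hypothesis my : measurable_fun setT y.
Hypothesis atomless : forall c, P [set t | y t = c] = 0%E.

Let H x := cdf_of P y x ^+ k.

Let L0 x : 0 <= cdf_of P y x. Proof. by case/andP: (cdf_of01 P my x). Qed.
Let L1 x : cdf_of P y x <= 1. Proof. by case/andP: (cdf_of01 P my x). Qed.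

Lemma cdf_exp_nd : {homo H : x z / x <= z}.
Proof. by move=> x z xz; rewrite /H lerXn2r ?nnegrE//; exact: cdf_of_nd. Qed.

Lemma cdf_exp01 x : 0 <= H x <= 1.
Proof. by rewrite exprn_ge0//= exprn_ile1. Qed.

Lemma continuous_cdf_exp : continuous H.
Proof.
move=> x; apply: (@continuous_comp _ _ _ (cdf_of P y) (fun z => z ^+ k)).
  exact: continuous_cdf_of.
exact: exprn_continuous.
Qed.

Let H_nd := cdf_exp_nd.
Let H01 := cdf_exp01.

(** Rivals bid independently, hence the power; the weak inequalities let ties be won, as in
    [objective]. *)
Definition win_prob b :=
  if r <= b then fine (P [set t | bid H r (y t) <= b]) ^+ k else 0.

Lemma measurable_bid_le b : measurable [set t | bid H r (y t) <= b].
Proof.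
apply: measurable_le_set => //.
apply: (measurableT_comp (f := bid H r)) => //.
apply: nondecreasing_measurable => //; exact: bid_nd.
Qed.

Lemma win_prob01 b : 0 <= win_prob b <= 1.
Proof.
rewrite /win_prob; case: ifP => _; last by rewrite lexx ler01.
have /andP[h0 h1] := fine_prob01 P (measurable_bid_le b).
by rewrite exprn_ge0//= exprn_ile1.
Qed.

(** A bid [b] need not be the bid of any value. It is compared with imitating values [z] that bid at
    most [b], to which [bid_deviation] applies, and in the limit these win at least as often as
    [b]. *)
Lemma win_deviation x b : (x - b) * win_prob b <= primitive H r x.
Proof.
rewrite /win_prob; case: ifPn => [rb|_]; last by rewrite mulr0 primitive_ge0.
have mB := measurable_bid_le b.
have /andP[l0 l1] := fine_prob01 P mB.
have [xb|bx] := leP x b.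
  apply: (@le_trans _ _ 0); last exact: primitive_ge0.
  by rewrite mulr_le0_ge0 ?subr_le0// exprn_ge0.
pose S := [set z | r <= z /\ bid H r z <= b].
have bidr : bid H r r = r.
  by apply/le_anti; rewrite bid_le ?bid_ge.
have Sr : S r by split=> //; rewrite bidr.
(* [u] climbs to the supremum of [S]; as the CDF is left-continuous it does not
   matter whether the supremum is attained. *)
suff [u [l [ul lel uS]]] : exists (u : R^nat) (l : R),
    [/\ cdf_of P y (u j) @[j --> \oo] --> l,
        fine (P [set t | bid H r (y t) <= b]) <= l &
        forall j, exists2 z, S z & u j <= z].
  have h : (x - b) * l ^+ k <= primitive H r x.
    have uk : (x - b) * H (u j) @[j --> \oo] --> (x - b) * l ^+ k.
      apply: cvgMr; apply: (cvg_comp _ (fun z : R => z ^+ k) ul).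
      exact: exprn_continuous.
    apply: (cvgr_to_le uk); apply: nearW => j; have [z [rz zb] ujz] := uS j.
    apply: (@le_trans _ _ ((x - b) * H z)).
      by rewrite ler_wpM2l ?subr_ge0 ?(ltW bx)//; exact: H_nd.
    exact: bid_deviation.
  apply: le_trans h; rewrite ler_wpM2l ?subr_ge0 ?(ltW bx)// lerXn2r ?nnegrE//.
  exact: le_trans lel.
have [ubS|nubS] := pselect (has_ubound S).
  have supS : has_sup S by split=> //; exists r.
  exists (fun j => sup S - j.+1%:R^-1), (cdf_of P y (sup S)); split.
  - exact: cdf_of_left.
  - apply: fine_prob_le => //; first exact: measurable_le_set.
    move=> t /= tb; have [rt|tr] := leP r (y t).
      by apply: ub_le_sup => //; split.
    by apply: (le_trans (ltW tr)); exact: ub_le_sup.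
  - move=> j; have [|z Sz sz] := sup_adherent (eps := j.+1%:R^-1) _ supS.
      by [].
    by exists z => //; exact: ltW.
(* An unbounded [S] has elements beyond every integer, and 1 bounds any probability. *)
exists (fun j => j%:R), 1; split.
- rewrite [X in _ --> X](_ : _ = fine (P setT)); last by rewrite probability_setT.
  apply: cvg_cdf_of_ndS => //; first by move=> i j ij; rewrite ler_nat.
  apply/seteqP; split=> // t _; exists (Num.truncn `|y t|).+1 => //=.
  by apply: (le_trans (ler_norm _)); apply/ltW; rewrite truncnS_gt.
- by [].
move=> j; apply: contrapT => nz; apply: nubS; exists j%:R => z Sz.
by rewrite leNgt; apply/negP => jz; apply: nz; exists z => //; exact: ltW.
Qed.

(** By left continuity [H] is still positive at some [z] in [[r, x[], and the area over [[z, x]] is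
    at least [(x - z) * H z]. *)
Lemma primitive_gt0 x : r < x -> 0 < H x -> 0 < primitive H r x.
Proof.
move=> rx Hx.
have : H (x - j.+1%:R^-1) @[j --> \oo] --> H x.
  apply: (@cvg_comp _ _ _ (fun j => cdf_of P y (x - j.+1%:R^-1))
    (fun z : R => z ^+ k) _ (nbhs (cdf_of P y x))); first exact: cdf_of_left.
  exact: exprn_continuous.
move=> /cvgrPdist_lt/(_ _ Hx)[j _ /(_ j (leqnn _)) /=].
rewrite ltr_norml => /andP[_ h].
pose z := Num.max r (x - j.+1%:R^-1).
have zx : z < x by rewrite /z gt_max rx gtrBl invr_gt0 ltr0n.
have Hz : 0 < H z.
  have : H (x - j.+1%:R^-1) <= H z by apply: H_nd; rewrite /z le_max lexx orbT.
  by rewrite /H in h *; lra.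
have /andP[lb _] := primitive_bounds H_nd H01 (r := r) (x := z) (y := x)
  ltac:(by rewrite /z le_max lexx) (ltW zx).
have := primitive_ge0 H01 r z.
have : 0 < (x - z) * H z by rewrite mulr_gt0// subr_gt0.
lra.
Qed.

Lemma bid_lt_value x : r < x -> bid H r x < x.
Proof.
move=> rx; have [Hx|Hx] := H_eq0_or_gt0 H01 x; first by rewrite bid_H0// ltW.
rewrite bid_pos ?(ltW rx)//.
by rewrite gtrBl divr_gt0// primitive_gt0.
Qed.

(** Rivals of value at most [x] bid no more, which gives one inequality. For the other,
    [win_deviation] at the own bid is divided by [x - bid H r x], positive for [r < x]; no strict
    monotonicity of [bid] is involved. *)
Lemma win_prob_bid x : x <> r -> win_prob (bid H r x) = cutoff H r x.
Proof.
move=> xr; rewrite /cutoff; have [rx|xr'] := leP r x; last first.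
  by rewrite bid_lt// /win_prob leNgt xr'.
have {xr}rx' : r < x by rewrite lt_neqAle rx eq_sym andbT; exact/eqP.
have bx := bid_lt_value rx'.
have wH : H x <= win_prob (bid H r x).
  rewrite /win_prob bid_ge//.
  have mB := measurable_bid_le (bid H r x).
  rewrite lerXn2r ?nnegrE//; first by case/andP: (fine_prob01 P mB).
  apply: fine_prob_le => //; first exact: measurable_le_set.
  by move=> t /= tx; exact: bid_nd.
have := win_deviation x (bid H r x).
have := bid_mulH H_nd H01 rx => bH dev.
have : (x - bid H r x) * (win_prob (bid H r x) - H x) <= 0.
  by rewrite mulrBr [X in _ - X]mulrBl bH; lra.
rewrite pmulr_rle0 ?subr_gt0// => h.
by apply/le_anti/andP; split; [lra|].
Qed.

(** Expected payment of the bid of [x] ([bid_mul_win_prob]), in a form whose continuity away from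
    [r] is visible. *)
Definition revenue x := x * cutoff H r x - primitive H r x.

Lemma bid_mul_win_prob x : x <> r -> bid H r x * win_prob (bid H r x) = revenue x.
Proof.
move=> xr; rewrite win_prob_bid// /revenue /cutoff; case: ifPn => rx.
  exact: bid_mulH.
by rewrite !mulr0 primitive_lt ?subr0// ltNge.
Qed.

Lemma revenue_bounds x : 0 <= r -> 0 <= x -> 0 <= revenue x <= x.
Proof.
move=> r0 x0; rewrite /revenue /cutoff; case: ifPn => rx.
  rewrite -(bid_mulH H_nd H01 rx); have /andP[h0 h1] := H01 x.
  have := bid_ge H_nd H01 rx; have := bid_le H_nd H01 rx => b1 b2.
  by rewrite mulr_ge0//= ?(le_trans r0)// (le_trans _ b1)// ler_piMr// (le_trans r0).
by rewrite mulr0 primitive_lt ?subr0 ?lexx// ltNge.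
Qed.

Lemma continuous_revenue x : x <> r -> {for x, continuous revenue}.
Proof.
move=> xr.
have cH : cutoff H r z @[z --> x] --> cutoff H r x.
  have [rx|xr'] : r < x \/ x < r by apply/orP; rewrite -neq_lt; apply/eqP => /esym.
    rewrite [X in _ --> X]/cutoff (ltW rx).
    apply: cvg_trans; last exact: (@continuous_cdf_exp x).
    apply: near_eq_cvg; near=> z; rewrite /cutoff; case: ifPn => //.
    rewrite -ltNge => zr; suff : r < z by rewrite ltNge (ltW zr).
    by near: z; apply: (cvgr_gt (f := id)); [exact: cvg_id|exact: rx].
  rewrite [X in _ --> X]/cutoff leNgt xr' /=.
  apply: cvg_trans; last exact: (@cvg_cst _ (0 : R) _ (nbhs x)).
  apply: near_eq_cvg; near=> z; rewrite /cutoff; case: ifPn => // rz.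
  suff : z < r by rewrite ltNge rz.
  by near: z; apply: (cvgr_lt (f := id)); [exact: cvg_id|exact: xr'].
have cI : primitive H r z @[z --> x] --> primitive H r x.
  apply/cvgrPdist_lt => e e0; near=> z.
  have : `|x - z| < e by near: z; apply: cvgr_dist_lt; [exact: cvg_id|exact: e0].
  apply: le_lt_trans; have [zx|xz] := leP z x.
    have /andP[h1 h2] := primitive_lip H_nd H01 r zx.
    by rewrite !ger0_norm ?subr_ge0// -subr_ge0.
  have /andP[h1 h2] := primitive_lip H_nd H01 r (ltW xz).
  by rewrite distrC [X in _ <= X]distrC !ger0_norm ?subr_ge0// ?(ltW xz)// -subr_ge0.
exact: (cvgB (cvgM (@cvg_id _ (nbhs x)) cH) cI).
Unshelve. all: by end_near. Qed.

End auction.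

(** * Auctions with a random item *)

Section random_auction.
Context {dZ dX : measure_display} {Z : measurableType dZ} {X : measurableType dX}.
Context {R : realType}.
Variables (F : probability Z R) (P : probability X R) (y : Z -> X -> R).
Variables (r : Z -> R) (k : nat).
Hypothesis my : measurable_fun setT (fun p : Z * X => y p.1 p.2).
Hypothesis mr : measurable_fun setT r.

Definition rival_cdf a x := cdf_of P (y a) x ^+ k.
Local Notation H := rival_cdf.

Lemma measurable_rival_section a : measurable_fun setT (y a).
Proof. exact: (measurableT_comp my (@measurable_pair1 _ _ Z X a)). Qed.
Local Notation mya := measurable_rival_section.

Lemma rival_cdf_nd a : {homo H a : x z / x <= z}.
Proof. by apply: cdf_exp_nd; exact: mya. Qed.

Lemma rival_cdf01 a x : 0 <= H a x <= 1.
Proof. by apply: cdf_exp01; exact: mya. Qed.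

Lemma measurable_rival_cdf : measurable_fun setT (fun p : Z * R => H p.1 p.2).
Proof.
rewrite /rival_cdf; apply: measurable_funX.
pose S := [set p : (Z * R) * X | y p.1.1 p.2 <= p.1.2].
have mS : measurable S.
  apply: measurable_le_set; last by apply: measurableT_comp => //.
  apply: (measurableT_comp my (g := fun p : (Z * R) * X => (p.1.1, p.2))).
  by apply: measurable_fun_pair => //; exact: measurableT_comp.
have -> : (fun p : Z * R => cdf_of P (y p.1) p.2) = fine \o (P \o xsection S).
  apply/funext => p; rewrite /cdf_of /=; congr (fine (P _)).
  by apply/seteqP; split=> x; rewrite /xsection /S /= inE.
by apply: measurableT_comp => //; exact: measurable_fun_xsection.
Qed.

(** The moving bounds are put into an indicator, so that Tonelli applies to a jointly measurable
    integrand on the whole line. *)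
Lemma measurable_primitive :
  measurable_fun setT (fun p : Z * R => primitive (H p.1) (r p.1) p.2).
Proof.
pose f := fun q : (Z * R) * R =>
  (if (r q.1.1 <= q.2) && (q.2 <= q.1.2) then H q.1.1 q.2 else 0)%:E.
have mf : measurable_fun setT f.
  apply/measurable_EFinP; apply: measurable_fun_ifT.
  - apply: measurable_and; apply: measurable_fun_ler => //.
    + by apply: measurableT_comp => //; exact: measurableT_comp.
    + exact: measurableT_comp.
  - apply: (measurableT_comp measurable_rival_cdf
      (g := fun q : (Z * R) * R => (q.1.1, q.2))).
    by apply: measurable_fun_pair => //; exact: measurableT_comp.
  - exact: measurable_cst.
have -> : (fun p : Z * R => primitive (H p.1) (r p.1) p.2) =
    fine \o (fubini_F (@lebesgue_measure R) f).
  apply/funext => p /=; rewrite /primitive /Rintegral /fubini_F; congr fine.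
  rewrite integral_mkcond; apply: eq_integral => s _.
  by rewrite patchE mem_setE in_itv /f /=; case: ifP.
apply: measurableT_comp => //; apply: measurable_fun_fubini_tonelli_F => //.
by move=> q; rewrite /f lee_fin; case: ifP => // _; case/andP: (rival_cdf01 q.1.1 q.2).
Qed.

Lemma measurable_joint_bid :
  measurable_fun setT (fun p : Z * R => bid (H p.1) (r p.1) p.2).
Proof.
pose h p := if 0 < H p.1 p.2 then H p.1 p.2 else 1.
have m0 : measurable_fun setT (fun p : Z * R => 0 < H p.1 p.2).
  by apply: measurable_fun_ltr => //; exact: measurable_rival_cdf.
have mh : measurable_fun setT h.
  by apply: measurable_fun_ifT => //; exact: measurable_rival_cdf.
have h0 p : 0 < h p by rewrite /h; case: ifP.
have mr1 : measurable_fun setT (fun p : Z * R => r p.1) by exact: measurableT_comp.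
rewrite (_ : (fun p => _) = fun p => if p.2 < r p.1 then p.2 else
   if 0 < H p.1 p.2 then p.2 - primitive (H p.1) (r p.1) p.2 * (h p)^-1 else r p.1).
  apply: measurable_fun_ifT => //; first exact: measurable_fun_ltr.
  apply: measurable_fun_ifT => //; apply: measurable_funB => //.
  apply: measurable_funM; first exact: measurable_primitive.
  exact: measurable_fun_inv_pos.
apply/funext => p; have [pr|rp] := ltP p.2 (r p.1); first by rewrite bid_lt.
have [H0|H0] := H_eq0_or_gt0 (rival_cdf01 p.1) p.2.
  by rewrite bid_H0// H0 ltxx.
by rewrite (bid_pos (rival_cdf_nd p.1) (rival_cdf01 p.1))// /h H0.
Qed.

Definition win_set (b : Z -> R) := [set p : Z * k.-tuple X |
  r p.1 <= b p.1 /\ forall i, bid (H p.1) (r p.1) (y p.1 (tnth p.2 i)) <= b p.1].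

Definition win_at (b : Z -> R) a := win_prob P (y a) k (r a) (b a).

Section win.
Variable b : Z -> R.
Hypothesis mb : measurable_fun setT b.

Lemma measurable_win_set : measurable (win_set b).
Proof.
have mb1 : measurable_fun setT (fun p : Z * k.-tuple X => b p.1).
  exact: measurableT_comp.
rewrite (_ : win_set b = [set p | r p.1 <= b p.1] `&`
  \bigcap_(i in [set: 'I_k])
    [set p | bid (H p.1) (r p.1) (y p.1 (tnth p.2 i)) <= b p.1]).
  apply: measurableI; first by apply: measurable_le_set => //; exact: measurableT_comp.
  apply: fin_bigcap_measurable => // i _; apply: measurable_le_set => //.
  apply: (measurableT_comp measurable_joint_bid
    (g := fun p : Z * k.-tuple X => (p.1, y p.1 (tnth p.2 i)))).
  apply: measurable_fun_pair => //.
  apply: (measurableT_comp my (g := fun p : Z * k.-tuple X => (p.1, tnth p.2 i))).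
  apply: measurable_fun_pair => //.
  exact: (measurableT_comp (measurable_tnth i)).
by apply/seteqP; split=> p [h1 h2]; split=> // i; [move=> _|]; exact: h2.
Qed.

Lemma iprod_win_section a : iprod P k (xsection (win_set b) a) = (win_at b a)%:E.
Proof.
rewrite /win_at /win_prob; have mB := measurable_bid_le P k (r a) (mya a) (b a).
case: ifPn => rb.
  have -> : xsection (win_set b) a =
      [set t | forall i, [set x | bid (H a) (r a) (y a x) <= b a] (tnth t i)].
    apply/seteqP; split=> t; rewrite /xsection /win_set /= inE /=; first by case.
    by move=> h; split.
  by rewrite EFin_expe fineK ?fin_num_measure//; exact: iprod_box.
rewrite (_ : xsection _ _ = set0) ?measure0// -subset0 => t.
by rewrite /xsection /win_set /= inE /= => -[rb']; rewrite rb' in rb.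
Qed.

Lemma measurable_win_at : measurable_fun setT (win_at b).
Proof.
have -> : win_at b = fine \o (iprod P k \o xsection (win_set b)).
  by apply/funext => a /=; rewrite iprod_win_section.
apply: measurableT_comp => //.
exact: (measurable_fun_xsection (iprod P k) measurable_win_set).
Qed.

Lemma win_at01 a : 0 <= win_at b a <= 1.
Proof. by apply: win_prob01; exact: mya. Qed.

(** Tonelli, integrating the rivals out for a fixed item; with [g] nonnegative, no integrability has
    to be known beforehand. *)
Lemma integral_joint_win (g : Z -> R) : measurable_fun setT g ->
  (forall a, 0 <= g a) ->
  (\int[F \x iprod P k]_p (g p.1 * \1_(win_set b) p)%:E =
   \int[F]_a (g a * win_at b a)%:E)%E.
Proof.
move=> mg g0; rewrite fubini_tonelli1; last 2 first.
- apply/measurable_EFinP; apply: measurable_funM.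
    exact: measurableT_comp.
  exact: measurable_indic measurable_win_set.
- by move=> p; rewrite lee_fin mulr_ge0.
apply: eq_integral => a _; rewrite /fubini_F /=.
under eq_integral do rewrite EFinM.
rewrite ge0_integralZl//; last 2 first.
- apply/measurable_EFinP.
  have mI : measurable_fun setT (\1_(win_set b) : _ -> R).
    exact: measurable_indic measurable_win_set.
  exact: (measurableT_comp mI (@measurable_pair1 _ _ Z _ a)).
- by rewrite lee_fin.
rewrite EFinM -iprod_win_section; congr (_ * _)%E.
by have /(congr1 (fun f => f a)) :=
  indic_fubini_tonelli_FE (iprod P k) measurable_win_set.
Qed.

End win.

End random_auction.

(** * Weak duality *)

Section bounded_integrals.
Context {dZ : measure_display} {Z : measurableType dZ} {R : realType}.
Variable F : probability Z R.

Lemma bounded_integrable (f : Z -> R) (M : R) : measurable_fun setT f ->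
  (forall a, 0 <= f a <= M) -> F.-integrable setT (EFin \o f).
Proof.
move=> mf fM; apply: measurable_bounded_integrable => //.
  by rewrite -ge0_fin_numE// fin_num_measure.
exists M; split; first exact: num_real.
move=> M' MM' a _ /=; have /andP[f0 fM'] := fM a.
by rewrite ger0_norm// (le_trans fM')// ltW.
Qed.

Lemma le_Rintegral_off_null (f g : Z -> R) (N : set Z) :
  measurable N -> F N = 0%E ->
  F.-integrable setT (EFin \o f) -> F.-integrable setT (EFin \o g) ->
  (forall a, ~ N a -> f a <= g a) -> Rintegral F setT f <= Rintegral F setT g.
Proof.
move=> mN N0 If Ig fg; rewrite /Rintegral.
rewrite (negligible_integral mN measurableT If N0).
rewrite (negligible_integral mN measurableT Ig N0).
apply: le_Rintegral => //.
- exact: measurableD.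
- by apply: (integrableS _ _ _ If) => //; exact: measurableD.
- by apply: (integrableS _ _ _ Ig) => //; exact: measurableD.
by move=> a [_ Na]; exact: fg.
Qed.

Lemma integrable_scale (f : Z -> R) c : F.-integrable setT (EFin \o f) ->
  F.-integrable setT (EFin \o (fun a => c * f a)).
Proof.
move=> If; have -> : EFin \o (fun a => c * f a) = (fun a => c%:E * (EFin \o f) a)%E.
  by apply/funext => a /=; rewrite EFinM.
exact: integrableZl.
Qed.

End bounded_integrals.

(** Here [x] and [x'] stand for the expected surplus at [s] and [t], and [z] for the expected spend
    at [s]: the tangent inequality meets the minimality of [t]. *)
Lemma slope_le_arith (R : realFieldType) (s t B x z x' : R) :
  (1 + s) * x + (s - t) * z <= (1 + t) * x' ->
  (1 + t) * x' + t * B <= (1 + s) * x + s * B -> (s - t) * (z - B) <= 0.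
Proof. lra. Qed.

Section optimal_bidding.
Context {dZ dX : measure_display} {Z : measurableType dZ} {X : measurableType dX}.
Context {R : realType}.
Variables (F : probability Z R) (P : probability X R) (y : Z -> X -> R).
Variables (r : Z -> R) (k : nat) (v : Z -> R) (omega B t : R) (N : set Z).
Hypothesis my : measurable_fun setT (fun p : Z * X => y p.1 p.2).
Hypothesis mr : measurable_fun setT r.
Hypothesis mv : measurable_fun setT v.
Hypothesis r0 : forall a, 0 < r a.
Hypothesis v0 : forall a, 0 <= v a <= omega.
Hypothesis t0 : 0 <= t.
Hypotheses (mN : measurable N) (N0 : F N = 0%E).
Hypothesis atomless : forall a, ~ N a -> forall c, P [set x | y a x = c] = 0%E.
Hypothesis not_reserve : forall a, ~ N a -> v a / (1 + t) <> r a.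

Local Notation H := (rival_cdf P y k).
Local Notation win b := (win_at P y r k b).
Local Notation mya := (measurable_rival_section my).
Local Notation H_nd := (rival_cdf_nd P k my).
Local Notation H01 := (rival_cdf01 P k my).
Local Notation E f := (Rintegral F setT f).

Definition paced_value s a := v a / (1 + s).
(** By the envelope formula, the best expected gain on item [a] when the paced value is taken for
    the true one. *)
Definition surplus s a := primitive (H a) (r a) (paced_value s a).
Definition spend s a := revenue P (y a) k (r a) (paced_value s a).
Definition best_bid a := bid (H a) (r a) (paced_value t a).

Lemma paced_value_bounds s a : 0 <= s -> 0 <= paced_value s a <= v a.
Proof.
move=> s0; have /andP[v0' _] := v0 a.
by rewrite /paced_value divr_ge0 ?addr_ge0//= ler_pdivrMr ?ltr_wpDr// ler_peMr// lerDl.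
Qed.

Lemma measurable_paced_value s : measurable_fun setT (paced_value s).
Proof. by apply: measurable_funM. Qed.

Let measurable_at (f : Z * R -> R) s : measurable_fun setT f ->
  measurable_fun setT (fun a => f (a, paced_value s a)).
Proof.
move=> mf; apply: (measurableT_comp mf (g := fun a => (a, paced_value s a))).
by apply: measurable_fun_pair => //; exact: measurable_paced_value.
Qed.

Lemma measurable_surplus s : measurable_fun setT (surplus s).
Proof. exact: (measurable_at s (measurable_primitive P k my mr)). Qed.

Lemma measurable_cutoff_at s :
  measurable_fun setT (fun a => cutoff (H a) (r a) (paced_value s a)).
Proof.
rewrite /cutoff; apply: measurable_fun_ifT => //.
  by apply: measurable_fun_ler => //; exact: measurable_paced_value.
exact: (measurable_at s (measurable_rival_cdf P k my)).
Qed.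

Lemma measurable_spend s : measurable_fun setT (spend s).
Proof.
apply: measurable_funB; last exact: measurable_surplus.
apply: measurable_funM; first exact: measurable_paced_value.
exact: measurable_cutoff_at.
Qed.

Lemma measurable_best_bid : measurable_fun setT best_bid.
Proof. exact: (measurable_at t (measurable_joint_bid P k my mr)). Qed.

Lemma surplus_bounds s a : 0 <= s -> 0 <= surplus s a <= omega.
Proof.
move=> s0; have /andP[x0 xv] := paced_value_bounds a s0.
have /andP[_ vo] := v0 a; rewrite /surplus primitive_ge0//=; last exact: H01.
have o0 : 0 <= omega by lra.
have [rx|xr] := leP (r a) (paced_value s a); last by rewrite primitive_lt.
apply: (le_trans (primitive_le_mul (H_nd a) (H01 a) rx)).
have /andP[h0 h1] := H01 a (paced_value s a).
have /ltW ra := r0 a.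
apply: (@le_trans _ _ (paced_value s a - r a)); last lra.
by rewrite ler_piMr// subr_ge0.
Qed.

Lemma spend_bounds s a : 0 <= s -> 0 <= spend s a <= omega.
Proof.
move=> s0; have /andP[x0 xv] := paced_value_bounds a s0.
have /andP[_ vo] := v0 a.
have /andP[h0 h1] := revenue_bounds P k (mya a) (ltW (r0 a)) x0.
by rewrite /spend h0/=; lra.
Qed.

Lemma integrable_surplus s : 0 <= s -> F.-integrable setT (EFin \o surplus s).
Proof.
move=> s0; apply: (@bounded_integrable _ _ _ F _ omega).
  exact: measurable_surplus.
by move=> a; exact: surplus_bounds.
Qed.

Lemma integrable_spend s : 0 <= s -> F.-integrable setT (EFin \o spend s).
Proof.
move=> s0; apply: (@bounded_integrable _ _ _ F _ omega).
  exact: measurable_spend.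
by move=> a; exact: spend_bounds.
Qed.

(* Expected payment is a subgradient (up to sign) of the dual function. *)
Lemma surplus_tangent s s' a : 0 <= s -> 0 <= s' ->
  (1 + s) * surplus s a + (s - s') * spend s a <= (1 + s') * surplus s' a.
Proof.
move=> s0 s'0.
have := primitive_tangent (H_nd a) (H01 a) (r a) (paced_value s a) (paced_value s' a).
rewrite -/(surplus s a) -/(surplus s' a) => tan.
have p' : 0 < 1 + s' by lra.
have := ler_wpM2l (ltW p') tan.
(* Both rescaled paced values equal [v a], so the difference in the tangent inequality, times
   [1 + s'], becomes [(s - s') * paced_value s a]. *)
have vs : paced_value s a * (1 + s) = v a by rewrite /paced_value divfK// gt_eqF// ltr_wpDr.
have vs' : paced_value s' a * (1 + s') = v a by rewrite /paced_value divfK// gt_eqF.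
apply: le_trans; rewrite /spend /revenue -/(surplus s a).
set C := cutoff _ _ _; rewrite le_eqVlt; apply/orP; left; apply/eqP.
have -> : (1 + s') * ((paced_value s' a - paced_value s a) * C + surplus s a) =
  (paced_value s' a * (1 + s') - paced_value s a * (1 + s')) * C
    + (1 + s') * surplus s a by ring.
by rewrite vs' -vs; ring.
Qed.

Definition dual s := (1 + s) * E (surplus s) + s * B.
Hypothesis dual_min : forall s, 0 <= s -> dual t <= dual s.

(** The subgradient is taken at [s] rather than at [t]: this signs the excess spend on each side of
    [t], and [cvg_spend] carries the sign to [t]. *)
Lemma dual_slope s : 0 <= s -> (s - t) * (E (spend s) - B) <= 0.
Proof.
move=> s0.
have : (1 + s) * E (surplus s) + (s - t) * E (spend s) <= (1 + t) * E (surplus t).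
  have Is := integrable_surplus s0; have It := integrable_surplus t0.
  have Ip := integrable_spend s0.
  have Zl c f := @integrable_scale _ _ _ F f c.
  rewrite -!RintegralZl// -RintegralD//; [|exact: Zl|exact: Zl].
  apply: le_Rintegral => //.
  - exact: (integrableD measurableT (Zl _ _ Is) (Zl _ _ Ip)).
  - exact: Zl.
  - by move=> a _; exact: surplus_tangent.
by move=> h; apply: slope_le_arith h _; exact: dual_min.
Qed.

(** Dominated convergence with bound [omega]. Off [N] the paced value at [t] differs from the
    reserve, where [revenue] is continuous. *)
Lemma cvg_spend (u : R^nat) : (forall j, 0 <= u j) -> u @ \oo --> t ->
  E (spend (u j)) @[j --> \oo] --> E (spend t).
Proof.
move=> u0 ut.
have o0 : 0 <= omega by have /andP[] := v0 point; exact: le_trans.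
have [|||||_ _ cv] := @dominated_convergence _ _ _ F setT measurableT
  (fun j => EFin \o spend (u j)) (EFin \o spend t) (cst omega%:E).
- by move=> j; apply/measurable_EFinP; exact: measurable_spend.
- by apply/measurable_EFinP; exact: measurable_spend.
- exists N; split=> // a; apply: contra_notP => Na _.
  apply: cvg_EFin; first by near=> j.
  have cr := continuous_revenue (mya a) (atomless Na) (not_reserve Na).
  apply: (@cvg_comp _ _ _ (fun j => paced_value (u j) a)
    (revenue P (y a) k (r a)) \oo (nbhs (paced_value t a))); last exact: cr.
  apply: cvgMr; apply: cvgV; first by rewrite gt_eqF// ltr_wpDr.
  by apply: cvgD => //; exact: cvg_cst.
- apply: (@bounded_integrable _ _ _ F (cst omega) omega) => //.
  by move=> a /=; rewrite o0 lexx.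
- apply: nearW => a j _ /=.
  by have /andP[h0 h1] := spend_bounds a (u0 j); rewrite ger0_norm// lee_fin.
apply: fine_cvg; rewrite fineK; first exact: cv.
by apply: integrable_fin_num => //; exact: integrable_spend.
Unshelve. all: by end_near. Qed.

Lemma spend_le_budget : E (spend t) <= B.
Proof.
apply: (cvgr_to_le (cvg_spend (u := fun j => t + j.+1%:R^-1) _ _)).
- by move=> j; rewrite addr_ge0.
- rewrite -[X in _ --> X]addr0; apply: cvgD; first exact: cvg_cst.
  exact: cvg_harmonic.
apply: nearW => j; have /dual_slope : 0 <= t + j.+1%:R^-1 by rewrite addr_ge0.
by rewrite addrAC subrr add0r pmulr_rle0// subr_le0.
Qed.

Lemma complementary_slackness : t * (E (spend t) - B) = 0.
Proof.
have [->|tn0] := eqVneq t 0; first by rewrite mul0r.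
have tp : 0 < t by rewrite lt_neqAle eq_sym tn0.
suff h : B <= E (spend t).
  by have -> : E (spend t) = B by [apply/le_anti; rewrite spend_le_budget h];
     rewrite subrr mulr0.
(* A positive [t] is approached from the left; the factor [t] keeps the sequence in the domain of
   the dual. *)
have u0 j : 0 <= t - t * j.+1%:R^-1 :> R.
  by rewrite subr_ge0 ler_piMr ?invf_le1// ?ler1n// ltr0n.
apply: (cvgr_to_ge (cvg_spend (u := fun j => t - t * j.+1%:R^-1) u0 _)).
  rewrite -[X in _ --> X]subr0; apply: cvgB; first exact: cvg_cst.
  rewrite -[X in _ --> X](mulr0 t); apply: cvgMr; exact: cvg_harmonic.
apply: nearW => j; have /dual_slope := u0 j.
rewrite addrAC subrr add0r mulNr oppr_le0 pmulr_rge0 ?subr_ge0//.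
by rewrite mulr_gt0// invr_gt0 ltr0n.
Qed.

Lemma best_bid_ge0 a : 0 <= best_bid a.
Proof.
have /andP[x0 _] := paced_value_bounds a t0.
rewrite /best_bid; have [rx|xr] := leP (r a) (paced_value t a).
  by apply: (le_trans (ltW (r0 a))); apply: bid_ge => //; [exact: H_nd|exact: H01].
by rewrite bid_lt.
Qed.

Lemma best_bid_spend a : ~ N a -> best_bid a * win best_bid a = spend t a.
Proof.
by move=> Na; apply: bid_mul_win_prob => //;
  [exact: mya|exact: atomless|exact: not_reserve].
Qed.

Lemma best_bid_surplus a : ~ N a ->
  v a * win best_bid a - (1 + t) * (best_bid a * win best_bid a) =
  (1 + t) * surplus t a.
Proof.
move=> Na; rewrite best_bid_spend// /win_at.
have -> : win_prob P (y a) k (r a) (best_bid a) = cutoff (H a) (r a) (paced_value t a).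
  by apply: win_prob_bid => //; [exact: mya|exact: atomless|exact: not_reserve].
have <- : paced_value t a * (1 + t) = v a.
  by rewrite /paced_value divfK// gt_eqF// ltr_wpDr.
by rewrite /spend /revenue -/(surplus t a); ring.
Qed.

(** The Lagrangian of item [a] is [1 + t] times the gain of an unconstrained bidder whose value is
    the paced one, so [win_deviation] bounds it. *)
Lemma deviation_surplus (b : Z -> R) a : ~ N a ->
  v a * win b a - (1 + t) * (b a * win b a) <= (1 + t) * surplus t a.
Proof.
move=> Na.
have := win_deviation (y := y a) (P := P) k (r a) (mya a) (atomless Na)
  (paced_value t a) (b a).
rewrite -/(win b a) => /(ler_wpM2l _); rewrite -/(surplus t a).
have p : 0 < 1 + t by rewrite ltr_wpDr.
move=> /(_ _ (ltW p)); apply: le_trans.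
have -> : v a = paced_value t a * (1 + t) by rewrite /paced_value divfK// gt_eqF.
rewrite /win_at; lra.
Qed.

Let mwin b : measurable_fun setT b -> measurable_fun setT (win b).
Proof. by move=> mb; apply: measurable_win_at. Qed.

Let win01 b a : 0 <= win b a <= 1.
Proof. exact: win_at01. Qed.

Let integrable_value (b : Z -> R) : measurable_fun setT b ->
  F.-integrable setT (EFin \o (fun a => v a * win b a)).
Proof.
move=> mb; apply: (@bounded_integrable _ _ _ F _ omega).
  by apply: measurable_funM => //; exact: mwin.
move=> a; have /andP[v1 v2] := v0 a; have /andP[w1 w2] := win01 b a.
by rewrite mulr_ge0//= (le_trans _ v2)// ler_piMr.
Qed.

Definition joint_payment (b : Z -> R) :=
  (\int[F \x iprod P k]_p (b p.1 * \1_(win_set P y r b) p)%:E)%E.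
Definition joint_objective (b : Z -> R) :=
  (\int[F \x iprod P k]_p ((v p.1 - b p.1) * \1_(win_set P y r b) p)%:E)%E.

Section bids.
Variable b : Z -> R.
Hypotheses (mb : measurable_fun setT b) (b0 : forall a, 0 <= b a).
Hypothesis pay_b : (joint_payment b <= B%:E)%E.

Lemma joint_paymentE :
  joint_payment b = (\int[F]_a (b a * win b a)%:E)%E.
Proof. exact: integral_joint_win. Qed.

Lemma integrable_payment : F.-integrable setT (EFin \o (fun a => b a * win b a)).
Proof.
apply/integrableP; split.
  by apply/measurable_EFinP; apply: measurable_funM => //; exact: mwin.
under eq_integral => a _ do
  rewrite /= ger0_norm ?mulr_ge0 ?(andP (win01 b a)).1//.
by rewrite -joint_paymentE (le_lt_trans pay_b)// ltry.
Qed.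

(** The integrand may change sign, so value and payment are separated first: the value part is
    bounded, and the budget makes the payment integrable. *)
Lemma joint_objectiveE : joint_objective b =
  (E (fun a => v a * win b a) - E (fun a => b a * win b a))%:E.
Proof.
rewrite /joint_objective.
have Ev := integral_joint_win F P k my mr mb mv (fun a => (andP (v0 a)).1).
have mW : measurable (win_set P y r b : set (Z * k.-tuple X)%type).
  exact: measurable_win_set.
have mI : measurable_fun setT
    (\1_(win_set P y r b) : (Z * k.-tuple X)%type -> R).
  exact: measurable_indic mW.
have fin f : F.-integrable setT (EFin \o f) ->
    (\int[F]_a (f a)%:E = (E f)%:E)%E.
  by move=> If; rewrite fineK//; exact: integrable_fin_num.
under eq_integral do rewrite mulrBl EFinB.
rewrite integralB_EFin//; first last.
- apply/integrableP; split.
    by apply/measurable_EFinP; apply: measurable_funM => //; exact: measurableT_comp.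
  under eq_integral => p _ do rewrite /= ger0_norm ?mulr_ge0//.
  by rewrite (le_lt_trans pay_b)// ltry.
- apply/integrableP; split.
    by apply/measurable_EFinP; apply: measurable_funM => //; exact: measurableT_comp.
  under eq_integral => p _ do rewrite /= ger0_norm ?mulr_ge0 ?(andP (v0 p.1)).1//.
  by rewrite Ev fin ?ltry//; exact: integrable_value.
rewrite -/(joint_payment b) joint_paymentE Ev !fin//.
- exact: integrable_payment.
- exact: integrable_value.
Qed.

End bids.

Lemma expected_payment_best_bid : joint_payment best_bid = (E (spend t))%:E.
Proof.
rewrite joint_paymentE; [|exact: measurable_best_bid|exact: best_bid_ge0].
rewrite (eq_integral_off_null (g := EFin \o spend t) mN N0); last first.
  by move=> a _ Na; rewrite best_bid_spend.
by rewrite fineK//; apply: integrable_fin_num => //; exact: integrable_spend.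
Qed.

Lemma best_bid_feasible : (joint_payment best_bid <= B%:E)%E.
Proof. by rewrite expected_payment_best_bid lee_fin spend_le_budget. Qed.

Lemma best_bid_optimal (b : Z -> R) : measurable_fun setT b ->
  (forall a, 0 <= b a) -> (joint_payment b <= B%:E)%E ->
  (joint_objective b <= joint_objective best_bid)%E.
Proof.
move=> mb b0 pb; have mb' := measurable_best_bid.
have b'0 := best_bid_ge0; have pb' := best_bid_feasible.
rewrite !joint_objectiveE// lee_fin.
have Ip := integrable_payment mb b0 pb.
have Ip' := integrable_payment mb' b'0 pb'.
have Iv := integrable_value mb; have Iv' := integrable_value mb'.
have Zl c f := @integrable_scale _ _ _ F f c.
have Lag f g : F.-integrable setT (EFin \o f) -> F.-integrable setT (EFin \o g) ->
    E f - (1 + t) * E g = E (fun a => f a - (1 + t) * g a).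
  by move=> If Ig; rewrite RintegralB ?RintegralZl//; exact: Zl.
have ILag f g : F.-integrable setT (EFin \o f) -> F.-integrable setT (EFin \o g) ->
    F.-integrable setT (EFin \o (fun a => f a - (1 + t) * g a)).
  by move=> If Ig; exact: (integrableB measurableT If (Zl _ _ Ig)).
have main : E (fun a => v a * win b a) - (1 + t) * E (fun a => b a * win b a) <=
    E (fun a => v a * win best_bid a) -
      (1 + t) * E (fun a => best_bid a * win best_bid a).
  rewrite !Lag//; apply: (le_Rintegral_off_null mN N0).
  - exact: ILag.
  - exact: ILag.
  by move=> a Na; rewrite best_bid_surplus//; exact: deviation_surplus.
have P' : E (fun a => best_bid a * win best_bid a) = E (spend t).
  have := expected_payment_best_bid; rewrite joint_paymentE// /Rintegral => ->.
  by [].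
have Pb : E (fun a => b a * win b a) <= B.
  move: pb; rewrite joint_paymentE// -[X in (X <= _)%E]fineK ?lee_fin//.
  exact: integrable_fin_num.
(* What remains of [main] is [t] times the payment of [b] minus that of [best_bid]; it is at most 0,
   because slackness makes the latter term [t * B]. *)
have := complementary_slackness; have := ler_wpM2l t0 Pb.
rewrite P' in main *; lra.
Qed.

End optimal_bidding.

(** * The paper's model *)

Section transfer.
Context {dZ dX : measure_display} {Z : measurableType dZ} {X : measurableType dX}.
Context {R : realType} (F : probability Z R) (G : probability X R) (k : nat).

Lemma prob_setC_eq1 (S : set Z) : measurable S -> F S = 1%E -> F (~` S) = 0%E.
Proof. by move=> mS S1; rewrite probability_setC// S1 subee. Qed.

(** The good profiles form a rectangle, a good item times a box of good rivals, of mass 1 by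
    [iprod_box]. *)
Lemma eq_joint_integral (N : set Z) (NX : set X)
    (f g : (Z * k.-tuple X)%type -> \bar R) :
  measurable N -> F N = 0%E -> measurable NX -> G NX = 0%E ->
  (forall a ths, ~ N a -> (forall i, ~ NX (tnth ths i)) -> f (a, ths) = g (a, ths)) ->
  (\int[F \x iprod G k]_p f p = \int[F \x iprod G k]_p g p)%E.
Proof.
move=> mN N0 mNX NX0 fg.
pose box := [set t : k.-tuple X | forall i, (~` NX) (tnth t i)].
have mbox : measurable box.
  rewrite (_ : box = \bigcap_(i in [set: 'I_k]) ((@tnth k X)^~ i @^-1` (~` NX))).
    apply: fin_bigcap_measurable => // i _.
    rewrite -[X in measurable X]setTI; apply: measurable_tnth => //.
    exact: measurableC.
  by apply/seteqP; split=> t /= h i; [move=> _|]; exact: h.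
pose M := ~` ((~` N) `*` box).
have mNb : measurable ((~` N) `*` box) by apply: measurableX => //; exact: measurableC.
have mM : measurable M by exact: measurableC.
have M0 : (F \x iprod G k)%E M = 0%E.
  have one : (F \x iprod G k)%E ((~` N) `*` box) = 1%E.
    have FN : F (~` N) = 1%E by rewrite probability_setC// N0 sube0.
    have GN : G (~` NX) = 1%E by rewrite probability_setC// NX0 sube0.
    have bE : iprod G k box = 1%E.
      transitivity (G (~` NX) ^+ k)%E; first by apply: iprod_box; exact: measurableC.
      rewrite GN; elim: (k) => [|j IH]; first by rewrite expe0.
      by rewrite expeS IH mule1.
    transitivity (F (~` N) * iprod G k box)%E; last by rewrite FN bE mule1.
    by apply: product_measure1E => //; exact: measurableC.
  by rewrite [LHS](probability_setC _ mNb) [X in (1 - X)%E]one subee.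
apply: (eq_integral_off_null mM M0) => -[a ths] _ nM.
have [Na h] : ((~` N) `*` box) (a, ths) by exact: contrapT.
exact: fg.
Qed.

End transfer.

Section tuple_sets.
Context {dX : measure_display} {X : measurableType dX} {R : realType} {d : nat}.

Lemma measurable_Theta (U Bmin : R) : measurable (Theta (d := d) U Bmin).
Proof.
pose T := (d.-tuple R * R)%type.
have mt i : measurable_fun setT (fun th : T => tnth th.1 i).
  exact: (measurableT_comp (measurable_tnth i) measurable_fst).
rewrite (_ : Theta U Bmin =
  (\bigcap_(i in [set: 'I_d])
     ([set th : T | 0 < tnth th.1 i] `&` [set th : T | tnth th.1 i < U])) `&`
  ([set th : T | Bmin < th.2] `&` [set th : T | th.2 < U])).
  apply: measurableI.
    by apply: fin_bigcap_measurable => // i _; apply: measurableI;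
      exact: measurable_lt_set.
  by apply: measurableI; exact: measurable_lt_set.
apply/seteqP; split=> th /=.
  by move=> [h /andP[h1 h2]]; split=> // i _ /=; apply/andP; exact: h.
by move=> [h [h1 h2]]; split; [move=> i; apply/andP; exact: h|apply/andP].
Qed.

Lemma measurable_fiber (K : X -> d.-tuple R) v : measurable_fun setT K ->
  measurable [set x | K x = v].
Proof.
move=> mK; rewrite (_ : [set x | _] = \bigcap_(i in [set: 'I_d])
    [set x | tnth (K x) i = tnth v i]).
  apply: fin_bigcap_measurable => // i _; apply: measurable_eq_set => //.
  exact: (measurableT_comp (measurable_tnth i) mK).
apply/seteqP; split=> x /= h; first by move=> i _ /=; rewrite h.
by apply: eq_from_tnth => i; exact: h.
Qed.

Lemma measurable_scalet (c : X -> R) (f : X -> d.-tuple R) :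
  measurable_fun setT c -> measurable_fun setT f ->
  measurable_fun setT (fun x => scalet (c x) (f x)).
Proof.
move=> mc mf; apply/measurable_fun_tnthP => i.
rewrite (_ : _ \o _ = fun x => c x * tnth (f x) i).
  by apply: measurable_funM => //; move/measurable_fun_tnthP : mf => /(_ i).
by apply/funext => x /=; rewrite tnth_mktuple.
Qed.

(* For [2 <= d] a line through the origin lies in a hyperplane. *)
Lemma scalet_fiber0 (P : probability X R) (c : X -> R) (g : X -> d.-tuple R) v :
  (2 <= d)%N -> measurable_fun setT c -> (forall x, 0 < c x) ->
  measurable_fun setT g ->
  (forall u : d.-tuple R, (exists i, tnth u i != 0) ->
     P [set x | dotp u (g x) = 0] = 0%E) ->
  P [set x | scalet (c x) (g x) = v] = 0%E.
Proof.
move=> d2 mc c0 mg hyp.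
have [u [u0 uv]] := exists_orthogonal v d2.
apply: (measure_null_sub _ _ _ (hyp u u0)).
- by apply: measurable_fiber; exact: measurable_scalet.
- by apply: measurable_eq_set => //; exact: measurable_dotp.
move=> x /= xv; move: uv; rewrite -xv dotpC dotp_scalel dotpC => /eqP.
by rewrite mulf_eq0 gt_eqF//= => /eqP.
Qed.

End tuple_sets.

Section lebesgue_null.
Context {R : realType} {d : nat}.

Lemma prob_hyperplane (F : probability (d.-tuple R) R) (c : d.-tuple R) :
  has_density leb_vec F -> (exists i, tnth c i != 0) ->
  F [set a | dotp c a = 0] = 0%E.
Proof.
move=> dF c0; apply: (@density_null _ _ _ F (@leb_vec R d) _ dF).
- by apply: measurable_eq_set => //; exact: measurable_dotp.
- exact: leb_vec_hyperplane.
Qed.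

Lemma prob_hyperplane_typ (G : probability (d.-tuple R * R)%type R) (c : d.-tuple R) :
  has_density leb_typ G -> (exists i, tnth c i != 0) ->
  G [set th | dotp c th.1 = 0] = 0%E.
Proof.
move=> dG c0.
apply: (@density_null _ _ _ G (@leb_typ R d) _ dG).
  by apply: measurable_eq_set => //; exact: measurable_dotp.
rewrite (_ : [set th | _] = [set a | dotp c a = 0] `*` setT); last first.
  by apply/seteqP; split=> th //= [].
transitivity (leb_vec [set a | dotp c a = 0%R] * @lebesgue_measure R setT)%E.
  apply: product_measure1E => //.
  by apply: measurable_eq_set => //; exact: measurable_dotp.
by rewrite leb_vec_hyperplane// mul0e.
Qed.

End lebesgue_null.

Section model.
Context {R : realType} {d : nat}.
Variables (n : nat) (U Bmin : R).
Variables (G : probability (d.-tuple R * R)%type R).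
Variables (mu mub : (d.-tuple R * R)%type -> R) (Nmu : set (d.-tuple R * R)%type).
Hypothesis mmub : measurable_fun setT mub.
Hypothesis mub0 : forall th, 0 <= mub th.
Hypotheses (mNmu : measurable Nmu) (Nmu0 : G Nmu = 0%E).
Hypothesis mu_mub : forall th, Theta U Bmin th -> ~ Nmu th -> mu th = mub th.
Hypothesis GT : G (Theta U Bmin) = 1%E.

Let scale_gt0 th : 0 < (1 + mub th)^-1.
Proof. by rewrite invr_gt0 ltr_wpDr. Qed.

Lemma measurable_pacing_scale : measurable_fun setT (fun th => (1 + mub th)^-1).
Proof.
by apply: measurable_fun_inv_pos => [th|]; [rewrite ltr_wpDr|exact: measurable_funD].
Qed.

Lemma pacedE a th : paced mub a th = dotp (scalet (1 + mub th)^-1 th.1) a.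
Proof. by rewrite dotp_scalel mulrC. Qed.

Lemma measurable_paced :
  measurable_fun setT (fun p : d.-tuple R * (d.-tuple R * R) => paced mub p.1 p.2).
Proof.
under eq_fun do rewrite pacedE.
apply: measurable_dotp => //; apply: measurable_scalet.
  exact: (measurableT_comp measurable_pacing_scale).
exact: measurableT_comp.
Qed.

Lemma lam_cdfE a x : lam_cdf U Bmin G mu a x = cdf_of G (paced mub a) x.
Proof.
rewrite /lam_cdf /cdf_of; congr fine; rewrite integral_mkcond.
have mTC : measurable (~` Theta (d := d) U Bmin) by apply: measurableC; exact: measurable_Theta.
have T0 : G (~` Theta U Bmin) = 0%E by apply: prob_setC_eq1 => //; exact: measurable_Theta.
have mN : measurable (Nmu `|` ~` Theta U Bmin) by exact: measurableU.
have N0 : G (Nmu `|` ~` Theta U Bmin) = 0%E by rewrite null_set_setU.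
set S := [set th | paced mub a th <= x].
transitivity (\int[G]_th (\1_S th)%:E)%E; last first.
  rewrite integral_indic ?setIT//; apply: measurable_le_set => //.
  exact: (measurableT_comp measurable_paced (@measurable_pair1 _ _ _ _ a)).
apply: (eq_integral_off_null mN N0) => th _ /not_orP[Nth /contrapT Tth].
have thE : paced mu a th = paced mub a th by rewrite /paced mu_mub.
rewrite patchE mem_set//= !indicE; congr (_%:R%:E); congr nat_of_bool.
by apply/idP/idP; rewrite !inE /= thE.
Qed.

Lemma HcdfE a : Hcdf n U Bmin G mu a = rival_cdf G (paced mub) n.-1 a.
Proof. by apply/funext => x; rewrite /Hcdf lam_cdfE. Qed.

Lemma sigmaE r a x :
  sigma n U Bmin G r mu a x = bid (rival_cdf G (paced mub) n.-1 a) (r a) x.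
Proof. by rewrite -HcdfE. Qed.

(** Here [K] is the paced weight vector. Types sharing one value of [K] have weights on a single
    line through the origin, so its fibers are null. *)
Lemma ae_atomless (F : probability (d.-tuple R) R) : (2 <= d)%N ->
  has_density leb_vec F -> has_density leb_typ G ->
  exists N, [/\ measurable N, F N = 0%E &
    forall a, ~ N a -> forall c, G [set th | paced mub a th = c] = 0%E].
Proof.
move=> d2 dF dG.
have [||c c0|th|N [mN N0 Nat]] := @ae_no_atom _ _ _ _ _ _ G F
  (fun th => scalet (1 + mub th)^-1 th.1) id.
- by apply: measurable_scalet => //; exact: measurable_pacing_scale.
- exact: measurable_id.
- exact: prob_hyperplane.
- apply: scalet_fiber0 => //; first exact: measurable_pacing_scale.
  by move=> c c0; exact: prob_hyperplane_typ.
exists N; split=> // a Na c; rewrite -[RHS](Nat a Na c).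
by congr (G _); apply/seteqP; split=> th /=; rewrite pacedE.
Qed.

End model.

(** * Payment and objective in terms of Borel representatives *)

Section bids_transfer.
Context {R : realType} {d : nat}.
Variables (n : nat) (U Bmin : R) (F : probability (d.-tuple R) R).
Variables (G : probability (d.-tuple R * R)%type R).
Variables (mu mub : (d.-tuple R * R)%type -> R) (Nmu : set (d.-tuple R * R)%type).
Hypothesis mmub : measurable_fun setT mub.
Hypothesis mub0 : forall th, 0 <= mub th.
Hypotheses (mNmu : measurable Nmu) (Nmu0 : G Nmu = 0%E).
Hypothesis mu_mub : forall th, Theta U Bmin th -> ~ Nmu th -> mu th = mub th.
Hypothesis GT : G (Theta U Bmin) = 1%E.
Variables (r rb v b b' : d.-tuple R -> R) (w : d.-tuple R) (N : set (d.-tuple R)).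
Hypotheses (mN : measurable N) (N0 : F N = 0%E).
Hypothesis r_rb : forall a, ~ N a -> r a = rb a.
Hypothesis b_b' : forall a, ~ N a -> b a = b' a.
Hypothesis v_dotp : forall a, ~ N a -> dotp w a = v a.

Let NX := Nmu `|` ~` Theta (d := d) U Bmin.
Let mTC : measurable (~` Theta (d := d) U Bmin).
Proof. by apply: measurableC; exact: measurable_Theta. Qed.
Let mNX : measurable NX. Proof. exact: measurableU. Qed.
Let NX0 : G NX = 0%E.
Proof.
rewrite /NX null_set_setU//; apply: prob_setC_eq1 => //; exact: measurable_Theta.
Qed.

Lemma competE a (ths : n.-1.-tuple (d.-tuple R * R)%type) :
  ~ N a -> (forall i, ~ NX (tnth ths i)) ->
  (compet (n := n) U Bmin G r mu a ths <= b a) <->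
  win_set G (paced mub) rb b' (a, ths).
Proof.
move=> Na NXths; rewrite /compet b_b'//.
have bE i : beta n U Bmin G r mu (tnth ths i) a =
    bid (rival_cdf G (paced mub) n.-1 a) (rb a) (paced mub a (tnth ths i)).
  rewrite /beta (sigmaE n mmub mub0 mNmu Nmu0 mu_mub GT) r_rb//; congr bid.
  have /not_orP[Ni /contrapT Ti] := NXths i.
  by rewrite /paced mu_mub.
rewrite big_tuple; split.
  move=> h; have [h1 h2] := (bigmax_leP _ _ _ _ h).
  split=> /=; first by rewrite -r_rb.
  by move=> i; rewrite -bE; exact: h2.
move=> [h1 h2]; apply/bigmax_leP; split; first by rewrite r_rb.
by move=> i _; rewrite bE; exact: h2.
Qed.

Lemma indic_competE a (ths : n.-1.-tuple (d.-tuple R * R)%type) :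
  ~ N a -> (forall i, ~ NX (tnth ths i)) ->
  \1_[set p | compet (n := n) U Bmin G r mu p.1 p.2 <= b p.1] (a, ths) =
  \1_(win_set G (paced mub) rb b') (a, ths) :> R.
Proof.
move=> Na NXths; rewrite !indicE; congr (_%:R); congr nat_of_bool.
by apply/idP/idP; rewrite !inE /= => /(competE Na NXths).
Qed.

Lemma paymentE : payment n U Bmin F G r mu b =
  joint_payment F G (paced mub) rb n.-1 b'.
Proof.
apply: (eq_joint_integral mN N0 mNX NX0) => a ths Na NXths /=.
by rewrite indic_competE// b_b'.
Qed.

Lemma objectiveE : objective n U Bmin F G r mu w b =
  joint_objective F G (paced mub) rb n.-1 v b'.
Proof.
apply: (eq_joint_integral mN N0 mNX NX0) => a ths Na NXths /=.
by rewrite indic_competE// b_b'// v_dotp.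
Qed.

End bids_transfer.

Lemma leb_measurable_fun_off_null {dT} (T : measurableType dT) (R : realType)
    (m : set T -> \bar R) (D N : set T) (f g : T -> R) :
  measurable_fun setT g -> measurable N -> m N = 0%E ->
  (forall x, D x -> ~ N x -> f x = g x) -> leb_measurable_fun m D f.
Proof.
move=> mg mN N0 fg Y mY.
(* Every subset of [N] is measurable for the completion, so [f] itself can be kept on [N]. *)
exists ((g @^-1` Y `&` ~` N) `|` (f @^-1` Y `&` N)); split; last first.
  apply/seteqP; split=> x /= [Dx h]; split=> //.
    have [Nx|Nx] := pselect (N x); first by right.
    by left; split=> //; rewrite -fg.
  by case: h => -[h Nx] //; rewrite fg.
exists (g @^-1` Y), N; split; first by rewrite -[X in measurable X]setTI; exact: mg.
split=> //; split=> // x /= [[[[h _]|[_ Nx]] gx] //|[gx h]].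
by apply: contrapT => Nx; apply: h; left.
Qed.

Section duality.
Context {R : realType} {d : nat}.
Variables (n : nat) (U Bmin : R) (F : probability (d.-tuple R) R).
Variables (G : probability (d.-tuple R * R)%type R).
Variables (mu mub : (d.-tuple R * R)%type -> R) (Nmu : set (d.-tuple R * R)%type).
Hypothesis mmub : measurable_fun setT mub.
Hypothesis mub0 : forall th, 0 <= mub th.
Hypotheses (mNmu : measurable Nmu) (Nmu0 : G Nmu = 0%E).
Hypothesis mu_mub : forall th, Theta U Bmin th -> ~ Nmu th -> mu th = mub th.
Hypothesis GT : G (Theta U Bmin) = 1%E.
Variables (r rb v : d.-tuple R -> R) (w : d.-tuple R) (N : set (d.-tuple R)).
Variable omega : R.
Hypotheses (mN : measurable N) (N0 : F N = 0%E).
Hypotheses (mrb : measurable_fun setT rb) (rb0 : forall a, 0 < rb a).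
Hypotheses (mv : measurable_fun setT v) (v0 : forall a, 0 <= v a <= omega).
Hypothesis r_rb : forall a, ~ N a -> r a = rb a.
Hypothesis v_dotp : forall a, ~ N a -> dotp w a = v a.

(** The indicator in [qdual] is absorbed by the primitive, which vanishes below the reserve. *)
Lemma qdualE B s : 0 <= s -> qdual n U Bmin F G r mu w B s =
  (dual F G (paced mub) rb n.-1 v B s)%:E.
Proof.
move=> s0; rewrite /qdual /dual [in RHS]EFinD [in RHS]EFinM; congr (_ * _ + _)%E.
rewrite (eq_integral_off_null
  (g := EFin \o surplus G (paced mub) rb n.-1 v s) mN N0); last first.
  move=> a _ Na; rewrite /= /surplus /paced_value (HcdfE n mmub mub0 mNmu Nmu0 mu_mub GT).
  rewrite r_rb// v_dotp// -/(primitive _ _ _) indicE; congr (_%:E).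
  have [rx|xr] := leP (rb a) (v a / (1 + s)).
    by rewrite mem_set ?mul1r//= r_rb// v_dotp.
  by rewrite primitive_lt// mulr0.
rewrite fineK//; apply: integrable_fin_num => //.
apply: (integrable_surplus F G n.-1 (omega := omega)) => //.
exact: measurable_paced.
Qed.

End duality.

Theorem theorem2 (R : realType) (n d : nat) (U Bmin omega : R)
    (A : set (d.-tuple R)) (F : probability (d.-tuple R) R)
    (G : probability (d.-tuple R * R)%type R) (r : d.-tuple R -> R) :
  (2 <= n)%N -> (2 <= d)%N -> 0 < U -> 0 < Bmin ->
  (* item types: A in the strictly positive orthant, F a distribution on A
     with a density *)
  A `<=` pos_orthant ->
  (exists A0, measurable A0 /\ A0 `<=` A /\ F A0 = 1%E) ->
  has_density leb_vec F ->
  (* buyer types: G a distribution on Theta with a density *)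
  G (Theta U Bmin) = 1%E ->
  has_density leb_typ G ->
  (* the bound omega *)
  0 < omega ->
  (forall w a, Theta_w U w -> A a -> dotp w a <= omega) ->
  (* reserve prices *)
  leb_measurable_fun leb_vec A r ->
  (forall a, A a -> 0 < r a) ->
  exists Theta' : set (d.-tuple R * R)%type,
    [/\ measurable Theta', Theta' `<=` Theta U Bmin, G Theta' = 1%E &
    forall mu : (d.-tuple R * R)%type -> R, is_pacing U Bmin mu ->
    forall w B, Theta' (w, B) ->
    forall tstar : R, 0 <= tstar ->
      (forall t : R, 0 <= t ->
         (qdual n U Bmin F G r mu w B tstar <= qdual n U Bmin F G r mu w B t)%E) ->
      optimal_Q n U Bmin F G r mu A w B
        (fun a => sigma n U Bmin G r mu a (dotp w a / (1 + tstar)))].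
Proof.
move=> n2 d2 U0 Bmin0 Apos [A0 [mA0 [A0A FA0]]] dF GT dG omega0 vomega mr r0.
have [r1 [Nr [mr1 mNr Nr0 r_r1]]] := leb_measurable_fun_borel mr.
pose rb a := if 0 < r1 a then r1 a else 1.
have mrb : measurable_fun setT rb.
  by apply: measurable_fun_ifT => //; exact: measurable_fun_ltr.
have rb0 a : 0 < rb a by rewrite /rb; case: ifP.
have r_rb a : A a -> ~ Nr a -> r a = rb a.
  by move=> Aa Na; rewrite /rb -r_r1// r0.
have mirb : measurable_fun setT (fun a => (rb a)^-1) by exact: measurable_fun_inv_pos.
(* A tie with the reserve reads [(a/r(a)).w = 1 + t], where [mu] does not occur. Hence the
   exceptional types [NG] are fixed before [mu], and serve every multiplier at once. *)
have [||c c0|a|NG [mNG NG0 noG]] := @ae_no_atom _ _ _ _ _ _ F G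
  (fun a => scalet (rb a)^-1 a) fst.
- by apply: measurable_scalet.
- exact: measurable_fst.
- exact: prob_hyperplane_typ.
- apply: scalet_fiber0 => // [a'|c c0]; first by rewrite invr_gt0.
  exact: prob_hyperplane.
exists (Theta U Bmin `\` NG); split.
- by apply: measurableD => //; exact: measurable_Theta.
- by move=> th [].
- have mT := @measurable_Theta R d U Bmin.
  have G0 : G (Theta U Bmin `&` NG) = 0%E.
    by apply: (measure_null_sub _ mNG _ NG0); [exact: measurableI|exact: subIsetr].
  by rewrite -[RHS]GT (measureDI G mT mNG) [X in (_ + X)%E]G0 adde0.
move=> mu [mmu mu0] w B [[/= wU BU] NGw] t t0 tmin.
have [mu1 [Nmu [mmu1 mNmu Nmu0 mu_mu1]]] := leb_measurable_fun_borel mmu.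
pose mub th := Num.max (mu1 th) 0.
have mmub : measurable_fun setT mub by exact: measurable_maxr.
have mub0 th : 0 <= mub th by rewrite /mub le_max lexx orbT.
have mu_mub th : Theta U Bmin th -> ~ Nmu th -> mu th = mub th.
  by move=> Tth Nth; rewrite /mub -mu_mu1// max_l// mu0.
have GNmu : G Nmu = 0%E := density_null dG mNmu Nmu0.
have FNr : F Nr = 0%E := density_null dF mNr Nr0.
have [NA [mNA NA0 noA]] := ae_atomless mmub mub0 d2 dF dG.
pose Nres := [set a : d.-tuple R | dotp (scalet (rb a)^-1 a) w = 1 + t].
have mNres : measurable Nres.
  by apply: measurable_eq_set => //; apply: measurable_dotp => //; exact: measurable_scalet.
have Nres0 : F Nres = 0%E := noG (w, B) NGw (1 + t).
have mA0C : measurable (~` A0) by exact: measurableC.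
have A0C0 : F (~` A0) = 0%E by exact: prob_setC_eq1.
(* This set of discarded items may depend on [mu], [w] and [t]: it only enters integrals against
   [F]. *)
pose N := (Nr `|` ~` A0) `|` (NA `|` Nres).
have mN : measurable N by do !apply: measurableU.
have N0 : F N = 0%E by rewrite !null_set_setU//; exact: measurableU.
have NA0' a : ~ N a -> A0 a by move=> Na; apply: contrapT => A0a; apply: Na; left; right.
have rN a : ~ N a -> r a = rb a.
  by move=> Na; apply: r_rb; [exact/A0A/NA0'|move=> Nra; apply: Na; left; left].
(* The bounds on values are known on [A] only; cutting off outside [A0], of full mass, makes them
   global and keeps [v] Borel. *)
pose v a := if a \in A0 then dotp w a else 0.
have mdw : measurable_fun setT (dotp w) by exact: measurable_dotp.
have dw0 a : A a -> 0 <= dotp w a.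
  move=> Aa; apply: sumr_ge0 => i _; have /andP[/ltW wi _] := wU i.
  by rewrite mulr_ge0// ltW//; exact: Apos.
have mv : measurable_fun setT v.
  apply: measurable_fun_ifT => //; apply: (measurable_fun_bool true).
  rewrite setTI (_ : _ @^-1` _ = A0)//.
  by apply/seteqP; split=> a /=; [move=> /set_mem|move=> /mem_set ->].
have v0 a : 0 <= v a <= omega.
  rewrite /v; case: ifPn => [/set_mem/A0A Aa|_]; last by rewrite lexx ltW.
  by rewrite dw0//= vomega.
have vN a : ~ N a -> dotp w a = v a.
  by move=> /NA0' A0a; rewrite /v mem_set.
have atomless a : ~ N a -> forall c, G [set th | paced mub a th = c] = 0%E.
  by move=> Na; apply: noA => NAa; apply: Na; right; left.
have not_reserve a : ~ N a -> v a / (1 + t) <> rb a.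
  move=> Na vr; apply: Na; right; right; rewrite /Nres /= dotp_scalel dotpC.
  have p : 1 + t != 0 by rewrite gt_eqF// ltr_wpDr.
  have va : v a = rb a * (1 + t) by rewrite -vr divfK.
  have [A0a|A0a] := pselect (A0 a); last first.
    by move: (rb0 a); rewrite -vr /v memNset// mul0r ltxx.
  have dv : dotp w a = v a by rewrite /v mem_set.
  by rewrite dv va mulKf// gt_eqF.
have my := measurable_paced mmub mub0.
have dual_min s : 0 <= s ->
    dual F G (paced mub) rb n.-1 v B t <= dual F G (paced mub) rb n.-1 v B s.
  move=> s0; have := tmin s s0.
  by rewrite !(qdualE n mmub mub0 mNmu GNmu mu_mub GT mN N0 mrb rb0 mv v0 rN vN).
have sN a : ~ N a -> sigma n U Bmin G r mu a (dotp w a / (1 + t)) =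
    best_bid G (paced mub) rb n.-1 v t a.
  by move=> Na; rewrite (sigmaE n mmub mub0 mNmu GNmu mu_mub GT) rN// vN.
split.
  split; [|split].
  (* The exceptional set here must be Lebesgue null, while [N] is only known to be [F]-null; so only
     [Nr] is removed and the value stays [dotp w]. *)
  - apply: (leb_measurable_fun_off_null
      (g := best_bid G (paced mub) rb n.-1 (dotp w) t) (N := Nr)) => //.
      exact: measurable_best_bid.
    by move=> a Aa Na; rewrite (sigmaE n mmub mub0 mNmu GNmu mu_mub GT) r_rb.
  - move=> a Aa; rewrite (sigmaE n mmub mub0 mNmu GNmu mu_mub GT).
    have x0 : 0 <= dotp w a / (1 + t) by rewrite divr_ge0 ?dw0// addr_ge0.
    have [rx|xr] := leP (r a) (dotp w a / (1 + t)); last by rewrite bid_lt.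
    apply: (le_trans (ltW (r0 a Aa))); apply: bid_ge => //.
      exact: rival_cdf_nd.
    exact: rival_cdf01.
  - rewrite (paymentE n mmub mub0 mNmu GNmu mu_mub GT mN N0 rN sN).
    exact: (best_bid_feasible my mrb mv rb0 v0 t0 mN N0 atomless not_reserve dual_min).
move=> b [mb [b0 pb]].
have [b1 [Nb [mb1 mNb Nb0 b_b1]]] := leb_measurable_fun_borel mb.
(* Truncation at 0 makes the Borel version of the competing bid nonnegative everywhere, and changes
   nothing where it agrees with [b] on [A]. *)
pose b2 a := Num.max (b1 a) 0.
have mb2 : measurable_fun setT b2 by exact: measurable_maxr.
have b20 a : 0 <= b2 a by rewrite /b2 le_max lexx orbT.
have FNb : F Nb = 0%E := density_null dF mNb Nb0.
pose N' := N `|` Nb.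
have mN' : measurable N' by exact: measurableU.
have N'0 : F N' = 0%E by rewrite null_set_setU.
have N'N a : ~ N' a -> ~ N a by move=> /not_orP[].
have b_b2 a : ~ N' a -> b a = b2 a.
  move=> /not_orP[Na Nba]; have Aa := A0A _ (NA0' a Na).
  by rewrite /b2 -b_b1// max_l// b0.
rewrite (objectiveE n mmub mub0 mNmu GNmu mu_mub GT mN' N'0
  (fun a Na => rN a (N'N a Na)) b_b2 (fun a Na => vN a (N'N a Na))).
rewrite (objectiveE n mmub mub0 mNmu GNmu mu_mub GT mN N0 rN sN vN).
apply: (best_bid_optimal my mrb mv rb0 v0 t0 mN N0 atomless not_reserve dual_min mb2 b20).
by rewrite -(paymentE n mmub mub0 mNmu GNmu mu_mub GT mN' N'0
  (fun a Na => rN a (N'N a Na)) b_b2).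
Qed.
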